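(* Let $n,m\ge1$ and let $p_{n,m}$ be stable of degree $n$ in $z$ and $m$ in $w$. In $L^2\!\left(\frac{d\sigma}{|p_{n,m}|^2}\right)$ define $$H_1=\operatorname{span}\{z^iw^j:0\le i\le n,0\le j\le m-1\}\ominus\operatorname{span}\{z^iw^j:0\le i\le n-1,0\le j\le m-1\},$$ $$\tilde H_2=\operatorname{span}\{z^iw^j:0\le i\le n-1,0\le j\le m\}\ominus\operatorname{span}\{z^iw^j:0\le i\le n-1,1\le j\le m\},$$ and let $K_1$, $K_2$ be their reproducing kernels. Then for all $(z,w),(z_1,w_1)\in\mathbb{C}^2$, $$p_{n,m}(z,w)\overline{p_{n,m}(z_1,w_1)}-\tilde p_{n,m}(z,w)\overline{\tilde p_{n,m}(z_1,w_1)}=(1-w\bar w_1)K_1(z,w;z_1,w_1)+(1-z\bar z_1)K_2(z,w;z_1,w_1).$$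
   Context: $\sigma$ is normalized Lebesgue measure on $\mathbb{T}^2$; $p_{n,m}$ is stable if it has no zeros in $\{|z|\le1,|w|\le1\}$. Inner product $\langle f,g\rangle=\int_{\mathbb{T}^2}f\bar g\,\frac{d\sigma}{|p_{n,m}|^2}$; $\ominus$ denotes orthogonal complement in this inner product. $\tilde p_{n,m}(z,w)=z^nw^m\overline{p_{n,m}(1/\bar z,1/\bar w)}$. The reproducing kernel of a finite-dimensional polynomial subspace $V$ with orthonormal basis $e_1,\dots,e_d$ is $K(z,w;z_1,w_1)=\sum_k e_k(z,w)\overline{e_k(z_1,w_1)}$. *)

(* Defs.v *)
From Stdlib Require Import Reals ClassicalEpsilon.
Open Scope R_scope.

Definition Cx : Type := (R * R)%type.
Definition Czero : Cx := (0, 0).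
Definition Cone : Cx := (1, 0).
Definition Cadd (a b : Cx) : Cx := (fst a + fst b, snd a + snd b).
Definition Copp (a : Cx) : Cx := (- fst a, - snd a).
Definition Csub (a b : Cx) : Cx := Cadd a (Copp b).
Definition Cmul (a b : Cx) : Cx :=
  (fst a * fst b - snd a * snd b, fst a * snd b + snd a * fst b).
Definition Cconj (a : Cx) : Cx := (fst a, - snd a).
Definition Cnorm2 (a : Cx) : R := fst a * fst a + snd a * snd a.
Definition Cmod (a : Cx) : R := sqrt (Cnorm2 a).
Definition RtoC (r : R) : Cx := (r, 0).
Definition Cscal (r : R) (a : Cx) : Cx := (r * fst a, r * snd a).
Fixpoint Cpow (a : Cx) (k : nat) : Cx :=
  match k with O => Cone | S k' => Cmul a (Cpow a k') end.
Definition Cexpi (t : R) : Cx := (cos t, sin t).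

Fixpoint csum (a len : nat) (f : nat -> Cx) : Cx :=
  match len with O => Czero | S l => Cadd (csum a l f) (f (a + l)%nat) end.

Definition fn2 : Type := Cx -> Cx -> Cx.

Definition in_span_box (i0 li j0 lj : nat) (f : fn2) : Prop :=
  exists c : nat -> nat -> Cx, forall z w : Cx,
    f z w = csum i0 li (fun i => csum j0 lj (fun j =>
              Cmul (c i j) (Cmul (Cpow z i) (Cpow w j)))).

Definition peval (c : nat -> nat -> Cx) (n m : nat) : fn2 := fun z w =>
  csum 0 (S n) (fun i => csum 0 (S m) (fun j =>
     Cmul (c i j) (Cmul (Cpow z i) (Cpow w j)))).

(* reflected polynomial  z^n w^m conj(p(1/conj z, 1/conj w)) *)
Definition ptilde (c : nat -> nat -> Cx) (n m : nat) : fn2 := fun z w =>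
  csum 0 (S n) (fun i => csum 0 (S m) (fun j =>
     Cmul (Cconj (c i j)) (Cmul (Cpow z (n - i)) (Cpow w (m - j))))).

Definition has_bidegree (c : nat -> nat -> Cx) (n m : nat) : Prop :=
  (exists j, (j <= m)%nat /\ c n j <> Czero) /\ (exists i, (i <= n)%nat /\ c i m <> Czero).

Definition stable (p : fn2) : Prop :=
  forall z w : Cx, Cmod z <= 1 -> Cmod w <= 1 -> p z w <> Czero.

(* Riemann integral (value of any integrability proof; arbitrary if none) *)
Definition RInt (f : R -> R) (a b : R) : R :=
  epsilon (inhabits 0)
    (fun I => exists pr : Riemann_integrable f a b, RiemannInt pr = I).

Definition torus_int_R (F : Cx -> Cx -> R) : R :=
  / (4 * PI * PI) *
  RInt (fun t2 => RInt (fun t1 => F (Cexpi t1) (Cexpi t2)) 0 (2 * PI)) 0 (2 * PI).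

Definition torus_int (F : Cx -> Cx -> Cx) : Cx :=
  (torus_int_R (fun z w => fst (F z w)), torus_int_R (fun z w => snd (F z w))).

Definition ip (p : fn2) (f g : fn2) : Cx :=
  torus_int (fun z w => Cscal (/ Cnorm2 (p z w)) (Cmul (f z w) (Cconj (g z w)))).

Definition ominus_box (p : fn2) (A B : fn2 -> Prop) (f : fn2) : Prop :=
  A f /\ forall g, B g -> ip p f g = Czero.

Definition onb (p : fn2) (V : fn2 -> Prop) (d : nat) (e : nat -> fn2) : Prop :=
  (forall k, (k < d)%nat -> V (e k)) /\
  (forall k l, (k < d)%nat -> (l < d)%nat ->
     ip p (e k) (e l) = if Nat.eqb k l then Cone else Czero) /\
  (forall f, V f -> exists a : nat -> Cx, forall z w,
     f z w = csum 0 d (fun k => Cmul (a k) (e k z w))).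

Definition kernel (d : nat) (e : nat -> fn2) (z w z1 w1 : Cx) : Cx :=
  csum 0 d (fun k => Cmul (e k z w) (Cconj (e k z1 w1))).

Definition H1 (p : fn2) (n m : nat) : fn2 -> Prop :=
  ominus_box p (in_span_box 0 (S n) 0 m) (in_span_box 0 n 0 m).
Definition H2t (p : fn2) (n m : nat) : fn2 -> Prop :=
  ominus_box p (in_span_box 0 n 0 (S m)) (in_span_box 0 n 1 m).

(* Main.v *)
(** Moving the terms with a negative sign across, the formula reads
      p p* + w w1* K1 + z z1* K2 = p~ p~* + K1 + K2,
    and both sides are reproducing kernels of the orthocomplement X of
    span{0 <= i < n, 1 <= j <= m} in span{0 <= i <= n, 0 <= j <= m}: if (e1), (e2) are
    orthonormal bases of H1 and H2, then (p, w e1, z e2) and (p~, e1, e2) are both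
    orthonormal bases of X.  All of this is elementary except two facts: z H2 is orthogonal
    to w^j for j >= 1, and H1 is orthogonal to z^i w^m for i < n; the second follows from the
    first by reflection and exchange of the variables.

    For the first fact, p is stable, so 1/p is a uniform limit of polynomials on the closed
    bidisk (Neumann series along the dilations p(tz, tw)).  This makes z^k w^l orthogonal to
    p as soon as k >= 1 or l >= 1.  The one-variable Christoffel-Darboux kernel of p(., w)
    then provides a dual basis "dual i" of the monomials z^i, i < n, which has degree at
    most 2m in w (shifted by w^m).  For g in H2 with moments h(i,k) = <g, z^i w^k>, the
    function u_N = sum_{m < k <= N} h(i,k) w^(k-m) dual(i) has the moments h(i,k) for
    m < k <= N and 0 for the other k >= 0; its coefficients at m < k <= N - m are those of
    g, hence 0.  So |u_N|^2 only involves moments of g of order close to N, which tend to 0,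
    and therefore all h(i,k) with k > m vanish. *)

Require Import Defs.
From Stdlib Require Import Reals Lra Psatz ClassicalEpsilon FunctionalExtensionality.
From Coquelicot Require Coquelicot.
From mathcomp Require all_boot all_order all_algebra ring lra zify Rstruct complex.
Open Scope R_scope.

Module TorusIntegral.

Import Coquelicot.
Import Defs.

(** * Integrals over the torus and the inner product *)

Definition continuous2 (F : R -> R -> R) : Prop :=
  forall t : R * R, continuous (fun t : R * R => F (fst t) (snd t)) t.

(** [RiemannInt] has the same value for all proofs of integrability, so the value picked by
    [epsilon] is determined as soon as one such proof exists. *)
Lemma RInt_eq_epsilon (f : R -> R) (a b : R) :
  ex_RInt f a b -> Defs.RInt f a b = RInt.RInt f a b.
Proof.
intros Hf; unfold Defs.RInt.
assert (pr : Riemann_integrable f a b) by (apply ex_RInt_Reals_0; exact Hf).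
destruct (epsilon_spec (inhabits 0)
  (fun I => exists pr : Riemann_integrable f a b, RiemannInt pr = I)) as [pr' <-].
- exists (RiemannInt pr), pr; reflexivity.
- symmetry; apply RInt_Reals.
Qed.

Lemma continuous2_slice F t2 : continuous2 F -> forall t1, continuous (fun t1 => F t1 t2) t1.
Proof.
intros HF t1.
apply (continuous_comp_2 (fun t : R => t) (fun _ : R => t2) F).
- apply continuous_id.
- apply continuous_const.
- exact (HF (t1, t2)).
Qed.

Lemma ex_RInt_slice F a b t2 : continuous2 F -> ex_RInt (fun t1 => F t1 t2) a b.
Proof.
intros HF; apply (@ex_RInt_continuous R_CompleteNormedModule).
intros t1 _; apply continuous2_slice; exact HF.
Qed.

(** Uniform continuity of [F] near the compact segment [[0, 2 * PI] x {t2}]; this makes the outer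
    integral exist. *)
Lemma continuous_RInt_slice F t2 : continuous2 F ->
  continuous (fun t2 => RInt.RInt (fun t1 => F t1 t2) 0 (2 * PI)) t2.
Proof.
intros HF.
assert (P := PI_RGT_0).
intros Q [e He].
(* Over an interval of length [2 * PI] this tolerance changes the integral by at most [e / 2], which
   keeps the final inequality strict. *)
assert (e0 : 0 < e / (4 * PI)).
{ apply Rdiv_lt_0_compat; [apply cond_pos | lra]. }
destruct (uniform_continuity_2d_1d F 0 (2 * PI) t2) with (eps := mkposreal _ e0)
  as [d Hd].
{ intros x _; apply continuity_2d_pt_filterlim; exact (HF (x, t2)). }
exists d; intros y Hy; apply He.
unfold ball; simpl; unfold AbsRing_ball, abs, minus, plus, opp; simpl.
change (Rabs (y - t2) < d) in Hy.
replace (RInt.RInt (fun t1 => F t1 y) 0 (2 * PI) + - RInt.RInt (fun t1 => F t1 t2) 0 (2 * PI))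
  with (RInt.RInt (fun t1 => F t1 y - F t1 t2) 0 (2 * PI)).
2: { apply (@RInt_minus R_CompleteNormedModule); apply ex_RInt_slice; exact HF. }
apply Rle_lt_trans with ((2 * PI - 0) * (e / (4 * PI))).
- apply abs_RInt_le_const; [lra | |].
  + apply (@ex_RInt_minus R_NormedModule); apply ex_RInt_slice; exact HF.
  + intros t Ht; apply Rlt_le, (Hd t t2 t y); try lra.
    * destruct d; simpl; lra.
    * apply Rabs_def2 in Hy; lra.
    * rewrite Rminus_diag, Rabs_R0; apply cond_pos.
- destruct e as [e pe]; simpl.
  replace ((2 * PI - 0) * (e / (4 * PI))) with (e / 2) by (field; lra); lra.
Qed.

Lemma ex_RInt_RInt_slice F a b : continuous2 F ->
  ex_RInt (fun t2 => RInt.RInt (fun t1 => F t1 t2) 0 (2 * PI)) a b.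
Proof.
intros HF; apply (@ex_RInt_continuous R_CompleteNormedModule).
intros t2 _; apply continuous_RInt_slice; exact HF.
Qed.

Definition torus_mean (F : R -> R -> R) : R :=
  / (4 * PI * PI) *
  RInt.RInt (fun t2 => RInt.RInt (fun t1 => F t1 t2) 0 (2 * PI)) 0 (2 * PI).

Lemma torus_int_R_mean F :
  continuous2 (fun t1 t2 => F (Cexpi t1) (Cexpi t2)) ->
  torus_int_R F = torus_mean (fun t1 t2 => F (Cexpi t1) (Cexpi t2)).
Proof.
intros HF; unfold torus_int_R, torus_mean; f_equal.
transitivity (Defs.RInt (fun t2 =>
  RInt.RInt (fun t1 => F (Cexpi t1) (Cexpi t2)) 0 (2 * PI)) 0 (2 * PI)).
- f_equal; apply functional_extensionality; intros t2.
  apply RInt_eq_epsilon, (ex_RInt_slice _ _ _ _ HF).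
- apply RInt_eq_epsilon, (ex_RInt_RInt_slice _ _ _ HF).
Qed.

Lemma torus_mean_plus F G : continuous2 F -> continuous2 G ->
  torus_mean (fun t1 t2 => F t1 t2 + G t1 t2) = torus_mean F + torus_mean G.
Proof.
intros HF HG; unfold torus_mean; rewrite <- Rmult_plus_distr_l; f_equal.
rewrite <- (@RInt_plus R_CompleteNormedModule) by (apply ex_RInt_RInt_slice; assumption).
apply RInt_ext; intros t2 _.
rewrite <- (@RInt_plus R_CompleteNormedModule) by (apply ex_RInt_slice; assumption).
reflexivity.
Qed.

Lemma torus_mean_scal a F : continuous2 F ->
  torus_mean (fun t1 t2 => a * F t1 t2) = a * torus_mean F.
Proof.
intros HF; unfold torus_mean.
rewrite <- (Rmult_assoc a), (Rmult_comm a), (Rmult_assoc _ a); f_equal.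
etransitivity; [|apply (@RInt_scal R_CompleteNormedModule), ex_RInt_RInt_slice, HF].
apply RInt_ext; intros t2 _.
apply (@RInt_scal R_CompleteNormedModule), ex_RInt_slice; assumption.
Qed.

Lemma torus_mean_const c : torus_mean (fun _ _ => c) = c.
Proof.
assert (P := PI_RGT_0); unfold torus_mean.
rewrite (RInt_ext _ (fun _ => (2 * PI - 0) * c)) by (intros t _; rewrite RInt_const; reflexivity).
rewrite RInt_const; unfold scal; simpl; unfold mult; simpl; field; lra.
Qed.

Lemma torus_mean_le F G : continuous2 F -> continuous2 G ->
  (forall t1 t2, F t1 t2 <= G t1 t2) -> torus_mean F <= torus_mean G.
Proof.
intros HF HG FG; unfold torus_mean.
assert (P := PI_RGT_0).
apply Rmult_le_compat_l.
- apply Rlt_le, Rinv_0_lt_compat; nra.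
- apply RInt_le; [lra | apply ex_RInt_RInt_slice; assumption ..|].
  intros t2 _; apply RInt_le; [lra | apply ex_RInt_slice; assumption ..|].
  intros t1 _; apply FG.
Qed.

Lemma sin_period_diff x k k' : sin (x + 2 * (INR k - INR k') * PI) = sin x.
Proof.
rewrite <- (sin_period _ k'), <- (sin_period x k); f_equal; ring.
Qed.

(** The antiderivative [sin (a * t + d) / a] takes equal values at both ends because [a] is a
    nonzero integer. *)
Lemma RInt_cos_period k k' d : k <> k' ->
  RInt.RInt (fun t => cos ((INR k - INR k') * t + d)) 0 (2 * PI) = 0.
Proof.
intros kk'.
assert (a0 : INR k - INR k' <> 0).
{ intros E; apply kk', INR_eq; lra. }
set (a := INR k - INR k') in *.
apply is_RInt_unique.
replace 0 with (minus (sin (a * (2 * PI) + d) / a) (sin (a * 0 + d) / a)) at 2.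
- apply (is_RInt_derive (fun t => sin (a * t + d) / a)).
  + intros t _; auto_derive; [trivial | field; exact a0].
  + intros t _; apply (@ex_derive_continuous _ R_NormedModule); auto_derive; trivial.
- unfold minus, plus, opp; simpl.
  replace (a * (2 * PI) + d) with (d + 2 * a * PI) by ring.
  unfold a; rewrite sin_period_diff; replace ((INR k - INR k') * 0 + d) with d by ring; ring.
Qed.

Lemma RInt_sin_period k k' d : k <> k' ->
  RInt.RInt (fun t => sin ((INR k - INR k') * t + d)) 0 (2 * PI) = 0.
Proof.
intros kk'; etransitivity; [|apply (RInt_cos_period k k' (d - PI / 2) kk')].
apply RInt_ext; intros t _; rewrite <- cos_shift, <- cos_neg; f_equal; ring.
Qed.

(** Cosine and sine are treated at once. If [k <> k'] the inner integral vanishes; otherwise the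
    integrand does not depend on [t1] and the outer integral decides. *)
Lemma torus_mean_wave (f : R -> R) k k' l l' :
  (forall x, continuous f x) ->
  (forall k k' d, k <> k' ->
    RInt.RInt (fun t => f ((INR k - INR k') * t + d)) 0 (2 * PI) = 0) ->
  torus_mean (fun t1 t2 => f ((INR k - INR k') * t1 + (INR l - INR l') * t2)) =
  if (Nat.eqb k k' && Nat.eqb l l')%bool then f 0 else 0.
Proof.
intros Hc Hf; assert (P := PI_RGT_0).
destruct (Nat.eqb_spec k k') as [<-|kk']; simpl.
- destruct (Nat.eqb_spec l l') as [<-|ll']; simpl.
  + rewrite <- (torus_mean_const (f 0)); unfold torus_mean; f_equal.
    apply RInt_ext; intros t2 _; apply RInt_ext; intros t1 _; f_equal; ring.
  + unfold torus_mean.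
    rewrite (RInt_ext _ (fun t2 => scal (2 * PI) (f ((INR l - INR l') * t2 + 0)))).
    * rewrite (@RInt_scal R_CompleteNormedModule).
      { rewrite Hf by exact ll'; unfold scal; simpl; unfold mult; simpl; ring. }
      apply (@ex_RInt_continuous R_CompleteNormedModule); intros t _.
      apply (continuous_comp (fun t => (INR l - INR l') * t + 0) f); [|apply Hc].
      apply (@ex_derive_continuous _ R_NormedModule); auto_derive; trivial.
    * intros t2 _.
      rewrite (RInt_ext _ (fun _ => f ((INR l - INR l') * t2 + 0))).
      { rewrite RInt_const; unfold scal; simpl; unfold mult; simpl; ring. }
      intros t1 _; f_equal; ring.
- unfold torus_mean.
  rewrite (RInt_ext _ (fun _ => 0)) by (intros t2 _; apply Hf, kk').
  rewrite RInt_const; unfold scal; simpl; unfold mult; simpl; ring.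
Qed.

Lemma torus_mean_cos k k' l l' :
  torus_mean (fun t1 t2 => cos ((INR k - INR k') * t1 + (INR l - INR l') * t2)) =
  if (Nat.eqb k k' && Nat.eqb l l')%bool then 1 else 0.
Proof.
rewrite torus_mean_wave, cos_0; [reflexivity | apply continuous_cos | apply RInt_cos_period].
Qed.

Lemma torus_mean_sin k k' l l' :
  torus_mean (fun t1 t2 => sin ((INR k - INR k') * t1 + (INR l - INR l') * t2)) = 0.
Proof.
rewrite torus_mean_wave, sin_0; [|apply continuous_sin | apply RInt_sin_period].
destruct (_ && _)%bool; reflexivity.
Qed.

(** * Continuity of complex-valued functions and a lower bound for stable polynomials *)

Definition Ccontinuous {X : UniformSpace} (F : X -> Cx) : Prop :=
  forall t, continuous (fun t => fst (F t)) t /\ continuous (fun t => snd (F t)) t.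

Lemma Ccontinuous_const (X : UniformSpace) (a : Cx) : Ccontinuous (fun _ : X => a).
Proof. intros t; split; apply continuous_const. Qed.

Lemma Ccontinuous_add (X : UniformSpace) (F G : X -> Cx) :
  Ccontinuous F -> Ccontinuous G -> Ccontinuous (fun t => Defs.Cadd (F t) (G t)).
Proof.
intros HF HG t; destruct (HF t), (HG t).
split; apply (@continuous_plus _ _ R_NormedModule); assumption.
Qed.

Lemma Ccontinuous_conj (X : UniformSpace) (F : X -> Cx) :
  Ccontinuous F -> Ccontinuous (fun t => Defs.Cconj (F t)).
Proof.
intros HF t; destruct (HF t).
split; [|apply (@continuous_opp _ _ R_NormedModule)]; assumption.
Qed.

Lemma Ccontinuous_mul (X : UniformSpace) (F G : X -> Cx) :
  Ccontinuous F -> Ccontinuous G -> Ccontinuous (fun t => Defs.Cmul (F t) (G t)).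
Proof.
intros HF HG t; destruct (HF t), (HG t).
split.
- apply (@continuous_minus _ _ R_NormedModule); apply (@continuous_mult _ R_AbsRing); assumption.
- apply (@continuous_plus _ _ R_NormedModule); apply (@continuous_mult _ R_AbsRing); assumption.
Qed.

Lemma continuous_Cnorm2 (X : UniformSpace) (F : X -> Cx) t :
  Ccontinuous F -> continuous (fun t => Cnorm2 (F t)) t.
Proof.
intros HF; destruct (HF t).
apply (@continuous_plus _ _ R_NormedModule); apply (@continuous_mult _ R_AbsRing); assumption.
Qed.

Lemma Ccontinuous_csum (X : UniformSpace) a len (F : nat -> X -> Cx) :
  (forall k, Ccontinuous (F k)) -> Ccontinuous (fun t => csum a len (fun k => F k t)).
Proof.
intros HF; induction len as [|len IH]; simpl.
- apply Ccontinuous_const.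
- apply (Ccontinuous_add _ _ (F (a + len)%nat)); [exact IH | apply HF].
Qed.

Lemma Ccontinuous_pow (X : UniformSpace) (F : X -> Cx) k :
  Ccontinuous F -> Ccontinuous (fun t => Cpow (F t) k).
Proof.
intros HF; induction k as [|k IH]; simpl.
- apply Ccontinuous_const.
- apply (Ccontinuous_mul _ F (fun t => Cpow (F t) k)); assumption.
Qed.

Lemma Ccontinuous_peval (X : UniformSpace) (F G : X -> Cx) c n m :
  Ccontinuous F -> Ccontinuous G -> Ccontinuous (fun t => peval c n m (F t) (G t)).
Proof.
intros HF HG; unfold peval.
apply (Ccontinuous_csum _ 0 (S n) (fun i t => csum 0 (S m) (fun j =>
  Defs.Cmul (c i j) (Defs.Cmul (Cpow (F t) i) (Cpow (G t) j))))); intros i.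
apply (Ccontinuous_csum _ 0 (S m) (fun j t =>
  Defs.Cmul (c i j) (Defs.Cmul (Cpow (F t) i) (Cpow (G t) j)))); intros j.
apply (Ccontinuous_mul _ (fun _ => c i j)); [apply Ccontinuous_const|].
apply (Ccontinuous_mul _ (fun t => Cpow (F t) i) (fun t => Cpow (G t) j));
  apply Ccontinuous_pow; assumption.
Qed.

Lemma Ccontinuous_expi_fst : @Ccontinuous (prod_UniformSpace R_UniformSpace R_UniformSpace) (fun t : R * R => Cexpi (fst t)).
Proof.
intros t; split; apply (continuous_comp fst).
- apply continuous_fst.
- apply continuous_cos.
- apply continuous_fst.
- apply continuous_sin.
Qed.

Lemma Ccontinuous_expi_snd : @Ccontinuous (prod_UniformSpace R_UniformSpace R_UniformSpace) (fun t : R * R => Cexpi (snd t)).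
Proof.
intros t; split; apply (continuous_comp snd).
- apply continuous_snd.
- apply continuous_cos.
- apply continuous_snd.
- apply continuous_sin.
Qed.

Lemma Cnorm2_ge0 a : 0 <= Cnorm2 a.
Proof. unfold Cnorm2; nra. Qed.

Lemma Cnorm2_eq0 a : Cnorm2 a = 0 -> a = Czero.
Proof.
destruct a as [x y]; unfold Cnorm2; simpl; intros H.
assert (x = 0) by nra; assert (y = 0) by nra; subst; reflexivity.
Qed.

Lemma Cmod_le1 a : Cnorm2 a <= 1 -> Defs.Cmod a <= 1.
Proof. intros H; unfold Defs.Cmod; rewrite <- sqrt_1; apply sqrt_le_1_alt, H. Qed.

(* Compactness is applied on the cube [-1,1]^4 to [|p|^2] plus a penalty vanishing on the bidisk. *)
Lemma stable_lower_bound c n m : stable (peval c n m) ->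
  exists d, 0 < d /\ forall z w, Cnorm2 z <= 1 -> Cnorm2 w <= 1 -> d <= Cnorm2 (peval c n m z w).
Proof.
intros Hst.
pose (X := prod_UniformSpace R_UniformSpace (prod_UniformSpace R_UniformSpace
  (prod_UniformSpace R_UniformSpace R_UniformSpace))).
pose (Z := fun x : X => (fst x, fst (snd x)) : Cx).
pose (W := fun x : X => (fst (snd (snd x)), snd (snd (snd x))) : Cx).
assert (HZ : Ccontinuous Z).
{ intros x; split; simpl; [apply continuous_fst|].
  apply (continuous_comp snd fst); [apply continuous_snd | apply continuous_fst]. }
assert (HW : Ccontinuous W).
{ intros x; split; simpl.
  - apply (continuous_comp (fun x : X => snd x) (fun y => fst (snd y))); [apply continuous_snd|].
    apply (continuous_comp snd fst); [apply continuous_snd | apply continuous_fst].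
  - apply (continuous_comp (fun x : X => snd x) (fun y => snd (snd y))); [apply continuous_snd|].
    apply (continuous_comp snd snd); apply continuous_snd. }
(* [pen s] is [2 * max (0, s - 1)]: zero on the disk and positive outside, so that [h] below is
   positive everywhere. *)
pose (pen := fun s : R => (Rabs (s - 1) + (s - 1))).
assert (Hpen : forall (F : X -> Cx) x, Ccontinuous F -> continuous (fun x => pen (Cnorm2 (F x))) x).
{ intros F x HF; unfold pen.
  assert (H1 : continuous (fun x => Cnorm2 (F x) - 1) x).
  { apply (@continuous_minus _ _ R_NormedModule); [apply continuous_Cnorm2, HF | apply continuous_const]. }
  apply (@continuous_plus _ _ R_NormedModule); [|exact H1].
  apply (continuous_comp (fun x => Cnorm2 (F x) - 1) Rabs); [exact H1 | apply continuous_Rabs]. }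
assert (pen0 : forall s, s <= 1 -> pen s = 0).
{ intros s Hs; unfold pen; rewrite Rabs_left1; lra. }
assert (pen_ge : forall s, 0 <= pen s).
{ intros s; unfold pen; assert (H := Rle_abs (- (s - 1))); rewrite Rabs_Ropp in H; lra. }
assert (pen_gt : forall s, 1 < s -> 0 < pen s).
{ intros s Hs; unfold pen; rewrite Rabs_pos_eq; lra. }
pose (h := fun x : X => Cnorm2 (peval c n m (Z x) (W x)) + (pen (Cnorm2 (Z x)) + pen (Cnorm2 (W x)))).
assert (Hh : forall x, continuous h x).
{ intros x; unfold h; apply (@continuous_plus _ _ R_NormedModule).
  - apply continuous_Cnorm2, Ccontinuous_peval; assumption.
  - apply (@continuous_plus _ _ R_NormedModule); apply Hpen; assumption. }
assert (hpos : forall x, 0 < h x).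
{ intros x; unfold h.
  assert (G1 := Cnorm2_ge0 (peval c n m (Z x) (W x))).
  assert (G2 := pen_ge (Cnorm2 (Z x))); assert (G3 := pen_ge (Cnorm2 (W x))).
  destruct (Rle_lt_dec (Cnorm2 (Z x)) 1) as [z1|z1].
  2: { apply pen_gt in z1; lra. }
  destruct (Rle_lt_dec (Cnorm2 (W x)) 1) as [w1|w1].
  2: { apply pen_gt in w1; lra. }
  destruct G1 as [G1|G1]; [lra|].
  exfalso; apply (Hst (Z x) (W x)); [apply Cmod_le1, z1 | apply Cmod_le1, w1|].
  apply Cnorm2_eq0; symmetry; exact G1. }
(* One number serves both as radius of a neighbourhood on which [h] exceeds [h x / 2] and as a lower
   bound of [h x / 2]; a uniform lower bound of these numbers then bounds [h] from below. *)
assert (Hd : forall x, exists d : posreal, d <= h x / 2 /\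
   forall y, ball x d y -> h x / 2 < h y).
{ intros x; assert (H2 : 0 < h x / 2) by (assert (H := hpos x); lra).
  destruct (Hh x (fun v => h x / 2 < v)) as [d Hd].
  - exists (mkposreal _ H2); intros v Hv.
    change (Rabs (v - h x) < h x / 2) in Hv; apply Rabs_def2 in Hv; lra.
  - assert (H3 : 0 < Rmin d (h x / 2)) by (apply Rmin_pos; [apply cond_pos | exact H2]).
    exists (mkposreal _ H3); split; simpl; [apply Rmin_r|].
    intros y Hy; apply Hd; revert Hy; apply ball_le, Rmin_l. }
pose (delta := fun t : Compactness.Tn 4 R => let '(a, (b, (c, (d, _)))) := t in
  proj1_sig (constructive_indefinite_description _ (Hd (a, (b, (c, d)))))).
destruct (compactness_value 4 (-1, (-1, (-1, (-1, tt)))) (1, (1, (1, (1, tt)))) delta)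
  as [d Hdelta].
exists d; split; [apply cond_pos|].
(* [compactness_value] gives the centre of a covering ball only under a double negation, hence the
   proof by contradiction. *)
intros [z1 z2] [w1 w2] Hz Hw; apply Rnot_lt_le; intros Hlt.
apply (Hdelta (z1, (z2, (w1, (w2, tt))))).
{ unfold Cnorm2 in Hz, Hw; simpl in *; repeat split; nra. }
intros [[a [b [a' [b' []]]]] [_ [Hc Hdd]]]; revert Hc Hdd; unfold delta.
destruct (constructive_indefinite_description _ _) as [e [He1 He2]]; simpl.
intros [B1 [B2 [B3 [B4 _]]]] Hde.
assert (Hb : h (a, (b, (a', b'))) / 2 < h (z1, (z2, (w1, w2)))).
{ apply He2; repeat split; assumption. }
unfold h at 2 in Hb.
change (Z (z1, (z2, (w1, w2)))) with ((z1, z2) : Cx) in Hb.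
change (W (z1, (z2, (w1, w2)))) with ((w1, w2) : Cx) in Hb.
rewrite (pen0 _ Hz), (pen0 _ Hw) in Hb; lra.
Qed.

(** * Complex-valued integrals over the torus *)

Definition torus_continuous (F : Cx -> Cx -> Cx) : Prop :=
  Ccontinuous (fun t : R * R => F (Cexpi (fst t)) (Cexpi (snd t))).

Lemma torus_continuous_fst F : torus_continuous F ->
  continuous2 (fun t1 t2 => fst (F (Cexpi t1) (Cexpi t2))).
Proof. intros HF t; apply HF. Qed.

Lemma torus_continuous_snd F : torus_continuous F ->
  continuous2 (fun t1 t2 => snd (F (Cexpi t1) (Cexpi t2))).
Proof. intros HF t; apply HF. Qed.

Lemma torus_int_mean F : torus_continuous F ->
  torus_int F = (torus_mean (fun t1 t2 => fst (F (Cexpi t1) (Cexpi t2))),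
                 torus_mean (fun t1 t2 => snd (F (Cexpi t1) (Cexpi t2)))).
Proof.
intros HF; unfold torus_int.
rewrite torus_int_R_mean by (apply torus_continuous_fst, HF).
rewrite torus_int_R_mean by (apply torus_continuous_snd, HF).
reflexivity.
Qed.

Lemma torus_mean_ext F G : (forall t1 t2, F t1 t2 = G t1 t2) -> torus_mean F = torus_mean G.
Proof.
intros FG; unfold torus_mean; f_equal; apply RInt_ext; intros t2 _.
apply RInt_ext; intros t1 _; apply FG.
Qed.

Lemma torus_int_ext F G :
  (forall t1 t2, F (Cexpi t1) (Cexpi t2) = G (Cexpi t1) (Cexpi t2)) ->
  torus_int F = torus_int G.
Proof.
intros FG; unfold torus_int, torus_int_R.
f_equal; f_equal; f_equal; apply functional_extensionality; intros t2; f_equal;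
  apply functional_extensionality; intros t1; rewrite FG; reflexivity.
Qed.

Lemma torus_int_add F G : torus_continuous F -> torus_continuous G ->
  torus_int (fun z w => Cadd (F z w) (G z w)) = Cadd (torus_int F) (torus_int G).
Proof.
intros HF HG.
rewrite (torus_int_mean F HF), (torus_int_mean G HG).
rewrite torus_int_mean by (apply (Ccontinuous_add _ _ _ HF HG)).
unfold Cadd; simpl; rewrite !torus_mean_plus;
  auto using torus_continuous_fst, torus_continuous_snd.
Qed.

Lemma torus_int_mul a F : torus_continuous F ->
  torus_int (fun z w => Cmul a (F z w)) = Cmul a (torus_int F).
Proof.
intros HF; rewrite (torus_int_mean F HF).
rewrite torus_int_mean by (apply (Ccontinuous_mul _ _ _ (Ccontinuous_const _ a) HF)).
assert (H1 := torus_continuous_fst F HF); assert (H2 := torus_continuous_snd F HF).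
unfold Cmul; simpl; f_equal.
- rewrite <- (torus_mean_scal (fst a)) by exact H1.
  replace (torus_mean (fun t1 t2 => fst a * fst (F (Cexpi t1) (Cexpi t2))) -
    snd a * torus_mean (fun t1 t2 => snd (F (Cexpi t1) (Cexpi t2)))) with
    (torus_mean (fun t1 t2 => fst a * fst (F (Cexpi t1) (Cexpi t2))) +
    (- snd a) * torus_mean (fun t1 t2 => snd (F (Cexpi t1) (Cexpi t2)))) by ring.
  rewrite <- (torus_mean_scal (- snd a)) by exact H2.
  rewrite <- torus_mean_plus.
  + apply torus_mean_ext; intros t1 t2; ring.
  + intros t; apply (@continuous_scal_r _ _ R_NormedModule (fst a)), H1.
  + intros t; apply (@continuous_scal_r _ _ R_NormedModule (- snd a)), H2.
- rewrite <- (torus_mean_scal (fst a)) by exact H2.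
  rewrite <- (torus_mean_scal (snd a)) by exact H1.
  rewrite <- torus_mean_plus.
  + apply torus_mean_ext; intros t1 t2; ring.
  + intros t; apply (@continuous_scal_r _ _ R_NormedModule (fst a)), H2.
  + intros t; apply (@continuous_scal_r _ _ R_NormedModule (snd a)), H1.
Qed.

Lemma torus_int_conj F : torus_continuous F ->
  torus_int (fun z w => Cconj (F z w)) = Cconj (torus_int F).
Proof.
intros HF; rewrite (torus_int_mean F HF).
rewrite torus_int_mean by (apply (Ccontinuous_conj _ _ HF)).
unfold Cconj; simpl; f_equal.
rewrite (torus_mean_ext _ (fun t1 t2 => -1 * snd (F (Cexpi t1) (Cexpi t2))))
  by (intros; ring).
rewrite torus_mean_scal by (apply torus_continuous_snd, HF); ring.
Qed.

Lemma continuous2_const c : continuous2 (fun _ _ => c).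
Proof. intros t; apply continuous_const. Qed.

Lemma torus_int_ge0 F : torus_continuous F ->
  (forall t1 t2, 0 <= fst (F (Cexpi t1) (Cexpi t2))) -> 0 <= fst (torus_int F).
Proof.
intros HF H; rewrite (torus_int_mean F HF), <- (torus_mean_const 0); simpl.
apply torus_mean_le; [apply continuous2_const | apply torus_continuous_fst, HF | exact H].
Qed.

Lemma torus_int_le F M : torus_continuous F ->
  (forall t1 t2, fst (F (Cexpi t1) (Cexpi t2)) <= M) -> fst (torus_int F) <= M.
Proof.
intros HF H; rewrite (torus_int_mean F HF), <- (torus_mean_const M); simpl.
apply torus_mean_le; [apply torus_continuous_fst, HF | apply continuous2_const | exact H].
Qed.

Lemma torus_int_real F : torus_continuous F ->
  (forall t1 t2, snd (F (Cexpi t1) (Cexpi t2)) = 0) -> snd (torus_int F) = 0.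
Proof.
intros HF H; rewrite (torus_int_mean F HF), <- (torus_mean_const 0); simpl.
apply torus_mean_ext, H.
Qed.

Lemma Cpow_expi t k : Cpow (Cexpi t) k = Cexpi (INR k * t).
Proof.
induction k as [|k IH].
- simpl; unfold Cexpi, Cone; rewrite Rmult_0_l, cos_0, sin_0; reflexivity.
- change (Cpow (Cexpi t) (S k)) with (Cmul (Cexpi t) (Cpow (Cexpi t) k)).
  rewrite IH, S_INR; unfold Cmul, Cexpi; simpl.
  replace ((INR k + 1) * t) with (t + INR k * t) by ring.
  rewrite cos_plus, sin_plus; f_equal; ring.
Qed.

Definition Cmon (k l : nat) : Cx -> Cx -> Cx := fun z w => Cmul (Cpow z k) (Cpow w l).

Lemma Ccontinuous_mon (X : UniformSpace) (F G : X -> Cx) k l :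
  Ccontinuous F -> Ccontinuous G -> Ccontinuous (fun t => Cmon k l (F t) (G t)).
Proof.
intros HF HG; unfold Cmon.
apply (Ccontinuous_mul _ (fun t => Cpow (F t) k) (fun t => Cpow (G t) l));
  apply Ccontinuous_pow; assumption.
Qed.

(** On the torus the integrand is a single wave in the two angles, whose real and imaginary parts
    are covered by [torus_mean_cos] and [torus_mean_sin]. *)
Lemma torus_int_mon k l a b :
  torus_int (fun z w => Cmul (Cmon k l z w) (Cconj (Cmon a b z w))) =
  if (Nat.eqb k a && Nat.eqb l b)%bool then Cone else Czero.
Proof.
rewrite torus_int_mean.
2: { apply (Ccontinuous_mul _
      (fun t => Cmon k l (Cexpi (fst t)) (Cexpi (snd t)))
      (fun t => Cconj (Cmon a b (Cexpi (fst t)) (Cexpi (snd t))))).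
  - apply Ccontinuous_mon; [apply Ccontinuous_expi_fst | apply Ccontinuous_expi_snd].
  - apply Ccontinuous_conj, Ccontinuous_mon;
      [apply Ccontinuous_expi_fst | apply Ccontinuous_expi_snd]. }
assert (E : forall t1 t2, Cmul (Cmon k l (Cexpi t1) (Cexpi t2))
    (Cconj (Cmon a b (Cexpi t1) (Cexpi t2))) =
    Cexpi ((INR k - INR a) * t1 + (INR l - INR b) * t2)).
{ intros t1 t2; unfold Cmon; rewrite !Cpow_expi.
  replace ((INR k - INR a) * t1 + (INR l - INR b) * t2)
    with ((INR k * t1 + INR l * t2) - (INR a * t1 + INR b * t2)) by ring.
  unfold Cexpi at 5; rewrite cos_minus, sin_minus, !cos_plus, !sin_plus.
  unfold Cmul, Cconj, Cexpi; simpl; f_equal; ring. }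
rewrite (torus_mean_ext _ (fun t1 t2 => cos ((INR k - INR a) * t1 + (INR l - INR b) * t2)))
  by (intros; rewrite E; reflexivity).
rewrite (torus_mean_ext (fun t1 t2 => snd _) (fun t1 t2 => sin ((INR k - INR a) * t1 + (INR l - INR b) * t2)))
  by (intros; rewrite E; reflexivity).
rewrite torus_mean_cos, torus_mean_sin.
destruct (_ && _)%bool; reflexivity.
Qed.

Lemma Cnorm2_expi t : Cnorm2 (Cexpi t) = 1.
Proof. unfold Cnorm2, Cexpi; simpl; assert (H := sin2_cos2 t); unfold Rsqr in H; lra. Qed.

Lemma stable_torus p t1 t2 : stable p -> Cnorm2 (p (Cexpi t1) (Cexpi t2)) <> 0.
Proof.
intros Hst E; apply Cnorm2_eq0 in E; revert E.
apply Hst; apply Cmod_le1; rewrite Cnorm2_expi; lra.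
Qed.

Lemma torus_continuous_weighted p f g : stable p ->
  torus_continuous p -> torus_continuous f -> torus_continuous g ->
  torus_continuous (fun z w => Cscal (/ Cnorm2 (p z w)) (Cmul (f z w) (Cconj (g z w)))).
Proof.
intros Hst Hp Hf Hg.
assert (H := Ccontinuous_mul _ _ _ Hf (Ccontinuous_conj _ _ Hg)).
intros t; destruct (H t) as [H1 H2]; simpl in H1, H2.
assert (Hn : continuous (fun t : R * R => / Cnorm2 (p (Cexpi (fst t)) (Cexpi (snd t)))) t).
{ apply (continuous_comp (fun t : R * R => Cnorm2 (p (Cexpi (fst t)) (Cexpi (snd t)))) Rinv).
  - apply (continuous_Cnorm2 _ (fun t : R * R => p (Cexpi (fst t)) (Cexpi (snd t))) t Hp).
  - apply continuous_Rinv, stable_torus, Hst. }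
split; simpl; apply (@continuous_mult _ R_AbsRing); assumption.
Qed.

(** * The weighted inner product *)

Section InnerProduct.

Variables p f g h : fn2.
Hypothesis p_stable : stable p.
Hypothesis p_cont : torus_continuous p.
Hypothesis f_cont : torus_continuous f.
Hypothesis g_cont : torus_continuous g.
Hypothesis h_cont : torus_continuous h.

Lemma ip_addl : ip p (fun z w => Cadd (f z w) (g z w)) h = Cadd (ip p f h) (ip p g h).
Proof.
unfold ip; rewrite <- torus_int_add by (apply torus_continuous_weighted; assumption).
apply torus_int_ext; intros t1 t2; unfold Cscal, Cmul, Cadd, Cconj; simpl; f_equal; ring.
Qed.

Lemma ip_mull a : ip p (fun z w => Cmul a (f z w)) g = Cmul a (ip p f g).
Proof.
unfold ip; rewrite <- torus_int_mul by (apply torus_continuous_weighted; assumption).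
apply torus_int_ext; intros t1 t2; unfold Cscal, Cmul, Cconj; simpl; f_equal; ring.
Qed.

Lemma ip_conj : ip p g f = Cconj (ip p f g).
Proof.
unfold ip; rewrite <- torus_int_conj by (apply torus_continuous_weighted; assumption).
apply torus_int_ext; intros t1 t2; unfold Cscal, Cmul, Cconj; simpl; f_equal; ring.
Qed.

(** A factor of modulus one cancels against its conjugate. With a coordinate function as [u],
    multiplication by [z] or [w] becomes isometric. *)
Lemma ip_shift (u : fn2) : (forall t1 t2, Cnorm2 (u (Cexpi t1) (Cexpi t2)) = 1) ->
  ip p (fun z w => Cmul (u z w) (f z w)) (fun z w => Cmul (u z w) (g z w)) = ip p f g.
Proof.
intros Hu; unfold ip; apply torus_int_ext; intros t1 t2; f_equal.
generalize (Hu t1 t2); set (a := u _ _); set (b := f _ _); set (d := g _ _).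
unfold Cnorm2, Cmul, Cconj; simpl; intros E; f_equal.
- transitivity ((fst a * fst a + snd a * snd a) * (fst b * fst d + snd b * snd d));
    [ring | rewrite E; ring].
- transitivity ((fst a * fst a + snd a * snd a) * (snd b * fst d - fst b * snd d));
    [ring | rewrite E; ring].
Qed.

Lemma ip_self_real : snd (ip p f f) = 0.
Proof.
apply torus_int_real; [apply torus_continuous_weighted; assumption|].
intros t1 t2; unfold Cscal, Cmul, Cconj; simpl; ring.
Qed.

Lemma ip_self_ge0 : 0 <= fst (ip p f f).
Proof.
apply torus_int_ge0; [apply torus_continuous_weighted; assumption|].
intros t1 t2; unfold Cscal; simpl.
assert (H1 := stable_torus p t1 t2 p_stable).
assert (H2 := Cnorm2_ge0 (p (Cexpi t1) (Cexpi t2))).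
apply Rmult_le_pos; [apply Rlt_le, Rinv_0_lt_compat; lra | nra].
Qed.

(** This turns uniform approximation on the torus into approximation in the weighted norm. *)
Lemma ip_self_le d M : 0 < d ->
  (forall t1 t2, d <= Cnorm2 (p (Cexpi t1) (Cexpi t2))) ->
  (forall t1 t2, Cnorm2 (f (Cexpi t1) (Cexpi t2)) <= M) ->
  fst (ip p f f) <= / d * M.
Proof.
intros d0 Hd HM; apply torus_int_le; [apply torus_continuous_weighted; assumption|].
intros t1 t2; unfold Cscal; simpl.
specialize (Hd t1 t2); specialize (HM t1 t2).
apply Rmult_le_compat.
- apply Rlt_le, Rinv_0_lt_compat; lra.
- nra.
- apply Rinv_le_contravar; assumption.
- unfold Cnorm2 in HM; lra.
Qed.

End InnerProduct.

(** The factor [|p|^2] cancels the weight, which leaves the orthonormality of monomials for Lebesgue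
    measure. *)
Lemma ip_multiple_mon p k l a b : stable p ->
  ip p (fun z w => Cmul (p z w) (Cmon k l z w)) (fun z w => Cmul (p z w) (Cmon a b z w)) =
  if (Nat.eqb k a && Nat.eqb l b)%bool then Cone else Czero.
Proof.
intros Hst; rewrite <- torus_int_mon; unfold ip; apply torus_int_ext; intros t1 t2.
generalize (stable_torus p t1 t2 Hst).
set (P := p _ _); set (u := Cmon k l _ _); set (v := Cmon a b _ _).
unfold Cnorm2, Cscal, Cmul, Cconj; simpl; intros E; f_equal; field; exact E.
Qed.

End TorusIntegral.

Module KernelFormula.

Import all_boot all_order all_algebra.
Import mathcomp.algebra_tactics.ring mathcomp.algebra_tactics.lra mathcomp.zify.zify.
Import Rstruct complex.
Import Defs TorusIntegral.
Set Implicit Arguments.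
Unset Strict Implicit.
Unset Printing Implicit Defensive.
Import Order.TTheory GRing.Theory Num.Theory.
Local Open Scope ring_scope.

(** * Hermitian forms on an algebra with two distinguished elements *)

Section Spans.

Variables (C : numClosedFieldType) (A : comNzRingType) (iota : {rmorphism C -> A}).

(** The elements [z] and [w] are parameters so that the variables can be exchanged later; an
    arbitrary set [S] of exponents covers boxes, half-planes and single columns alike. *)
Inductive mspan (z w : A) (S : nat -> nat -> bool) : A -> Prop :=
| mspan0 : mspan z w S 0
| mspan_cons i j a f : S i j -> mspan z w S f ->
    mspan z w S (iota a * (z ^+ i * w ^+ j) + f).

Variables z w : A.
Local Notation span := (mspan z w).

Lemma spanD S f g : span S f -> span S g -> span S (f + g).
Proof.
move=> Sf Sg; elim: Sf => [|i j a f' Sij _ IH]; first by rewrite add0r.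
by rewrite -addrA; apply: mspan_cons.
Qed.

Lemma spanZ S a f : span S f -> span S (iota a * f).
Proof.
elim=> [|i j b f' Sij _ IH]; first by rewrite mulr0; apply: mspan0.
by rewrite mulrDr mulrA -rmorphM; apply: mspan_cons.
Qed.

Lemma spanN S f : span S f -> span S (- f).
Proof. by move/(@spanZ S (-1)); rewrite rmorphN1 mulN1r. Qed.

Lemma spanB S f g : span S f -> span S g -> span S (f - g).
Proof. by move=> Sf /spanN; apply: spanD. Qed.

Lemma span_mon (S : nat -> nat -> bool) i j : S i j -> span S (z ^+ i * w ^+ j).
Proof.
move=> Sij; rewrite -[_ * _]addr0 -[X in X + 0]mul1r -(rmorph1 iota).
by apply: mspan_cons => //; apply: mspan0.
Qed.

Lemma span_sum (I : Type) (r : seq I) (Q : pred I) (F : I -> A) S :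
  (forall i, Q i -> span S (F i)) -> span S (\sum_(i <- r | Q i) F i).
Proof. by move=> SF; apply: big_ind => //; [apply: mspan0 | move=> *; apply: spanD]. Qed.

Lemma spanM (S1 S2 S : nat -> nat -> bool) f g :
  (forall i j k l, S1 i j -> S2 k l -> S (i + k)%N (j + l)%N) ->
  span S1 f -> span S2 g -> span S (f * g).
Proof.
move=> SS; elim=> [|i j a f' Sij _ IH] Sg; first by rewrite mul0r; apply: mspan0.
rewrite mulrDl; apply: spanD; last exact: IH.
rewrite -mulrA; apply: spanZ.
elim: Sg {IH} => [|k l b g' Skl _ IH]; first by rewrite mulr0; apply: mspan0.
rewrite mulrDr; apply: spanD => //.
have -> : z ^+ i * w ^+ j * (iota b * (z ^+ k * w ^+ l)) =
  iota b * (z ^+ (i + k) * w ^+ (j + l)) by rewrite !exprD; ring.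
by apply: spanZ; apply: span_mon; apply: SS.
Qed.

Lemma span_le (S1 S2 : nat -> nat -> bool) f :
  (forall i j, S1 i j -> S2 i j) -> span S1 f -> span S2 f.
Proof.
move=> SS; elim=> [|i j a f' Sij _ IH]; first exact: mspan0.
by apply: mspan_cons => //; apply: SS.
Qed.

Lemma span_shift (S1 S2 : nat -> nat -> bool) a b f :
  (forall i j, S1 i j -> S2 (a + i)%N (b + j)%N) ->
  span S1 f -> span S2 (z ^+ a * w ^+ b * f).
Proof.
move=> SS; apply: (@spanM (fun i j => (i == a) && (j == b))).
  by move=> i j k l /andP[/eqP-> /eqP->]; apply: SS.
by apply: span_mon; rewrite !eqxx.
Qed.


End Spans.

(** * Positive semidefinite Hermitian forms and the Cauchy-Schwarz inequality *)

Section Form.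

Variables (C : numClosedFieldType) (A : comNzRingType) (iota : {rmorphism C -> A}).
Variable B : A -> A -> C.

(** Positivity is only semidefinite here; definiteness on polynomials of low degree in [z] is
    derived in [form_definite] from the dual basis. *)
Record hermitian_form : Prop := HermitianForm {
  formDl : forall f g h, B (f + g) h = B f h + B g h;
  formZl : forall a f g, B (iota a * f) g = a * B f g;
  formC : forall f g, B g f = (B f g)^*;
  form_ge0 : forall f, 0 <= B f f }.

Hypothesis hB : hermitian_form.

Lemma formDr f g h : B f (g + h) = B f g + B f h.
Proof. by rewrite (formC hB) (formDl hB) rmorphD /= -!(formC hB). Qed.

Lemma formZr a f g : B f (iota a * g) = a^* * B f g.
Proof. by rewrite (formC hB) (formZl hB) rmorphM /= -(formC hB). Qed.

Lemma form0l g : B 0 g = 0.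
Proof. by rewrite -(mul0r 0) -(rmorph0 iota) (formZl hB) mul0r. Qed.

Lemma form0r g : B g 0 = 0.
Proof. by rewrite (formC hB) form0l rmorph0. Qed.

Lemma formNl f g : B (- f) g = - B f g.
Proof. by rewrite -mulN1r -(rmorphN1 iota) (formZl hB) mulN1r. Qed.

Lemma formNr f g : B f (- g) = - B f g.
Proof. by rewrite (formC hB) formNl rmorphN /= -(formC hB). Qed.

Lemma formBl f g h : B (f - g) h = B f h - B g h.
Proof. by rewrite (formDl hB) formNl. Qed.

Lemma formBr f g h : B f (g - h) = B f g - B f h.
Proof. by rewrite formDr formNr. Qed.

Lemma form_suml (I : Type) (r : seq I) (Q : pred I) (F : I -> A) g :
  B (\sum_(i <- r | Q i) F i) g = \sum_(i <- r | Q i) B (F i) g.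
Proof. exact: (big_morph (B^~ g) (fun x y => formDl hB x y g) (form0l g)). Qed.

Lemma form_sumr (I : Type) (r : seq I) (Q : pred I) (F : I -> A) g :
  B g (\sum_(i <- r | Q i) F i) = \sum_(i <- r | Q i) B g (F i).
Proof. exact: (big_morph (B g) (formDr g) (form0r g)). Qed.

Lemma form_eq0C f g : B f g = 0 -> B g f = 0.
Proof. by rewrite (formC hB f) => ->; rewrite rmorph0. Qed.

(** Positivity on [f - s B(f, g) g] for real [s] gives a quadratic inequality in [s]. The usual
    choice is the inverse of [B g g]; if [B g g = 0] the inequality is linear in [s] and fails for
    large [s] unless [B f g = 0]. *)
Lemma form_CS2 f g : `|B f g| ^+ 2 <= B f f * B g g.
Proof.
have gen (s : C) : s \is Num.real ->
    0 <= B f f - 2 * s * `|B f g| ^+ 2 + s ^+ 2 * `|B f g| ^+ 2 * B g g.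
  move=> sR; have := form_ge0 hB (f - iota (s * B f g) * g).
  rewrite formBl !formBr !(formZl hB) !formZr rmorphM /= (conj_Creal sR).
  rewrite (formC hB f g); set x := B f g; rewrite normCK.
  by congr (0 <= _); ring.
have [G0|Gn0] := eqVneq (B g g) 0.
  rewrite G0 mulr0; have [->|xn0] := eqVneq (B f g) 0.
    by rewrite normr0 expr0n.
  have x2 : 0 < `|B f g| ^+ 2 by rewrite exprn_gt0 ?normr_gt0.
  have F0 := form_ge0 hB f.
  (* At this value of [s] the inequality would read [0 <= B f f - 2 * (B f f + 1)]. *)
  have : (B f f + 1) / `|B f g| ^+ 2 \is Num.real.
    by apply: ger0_real; rewrite divr_ge0 ?ltW // ltr_wpDl.
  move/gen; rewrite G0 mulr0 addr0 -mulrA divfK ?gt_eqF //.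
  move=> H; suff : (0 : C) < 0 by rewrite ltxx.
  apply: le_lt_trans H _; rewrite -subr_gt0.
  have -> : 0 - (B f f - 2 * (B f f + 1)) = B f f + 2 by ring.
  by rewrite ltr_wpDl.
have G : 0 < B g g by rewrite lt_neqAle eq_sym Gn0 form_ge0.
have := gen (B g g)^-1; rewrite realV gtr0_real // => /(_ isT).
have -> : B f f - 2 * (B g g)^-1 * `|B f g| ^+ 2 +
   (B g g)^-1 ^+ 2 * `|B f g| ^+ 2 * B g g = B f f - `|B f g| ^+ 2 / B g g.
  by field.
by rewrite subr_ge0 ler_pdivrMr.
Qed.

Definition fnorm f := sqrtC (B f f).

Lemma fnorm_ge0 f : 0 <= fnorm f.
Proof. by rewrite sqrtC_ge0 form_ge0. Qed.

Lemma fnormK f : fnorm f ^+ 2 = B f f.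
Proof. exact: sqrtCK. Qed.

Lemma form_CS f g : `|B f g| <= fnorm f * fnorm g.
Proof.
rewrite -(@ler_pXn2r _ 2) ?nnegrE // ?mulr_ge0 ?fnorm_ge0 //.
by rewrite exprMn !fnormK form_CS2.
Qed.

Lemma form_null f g : B f f = 0 -> B f g = 0.
Proof.
move=> f0; apply/eqP; rewrite -normr_le0 (le_trans (form_CS _ _)) //.
by rewrite /fnorm f0 sqrtC0 mul0r.
Qed.

End Form.

(** Limits are taken through this lemma. For nonzero [x] the choice [e = |x| / (K + 1)] makes the
    bound smaller than [|x|]. *)
Lemma small_eq0 (C : numClosedFieldType) (x K : C) :
  0 <= K -> (forall e : C, 0 < e -> `|x| <= e * K) -> x = 0.
Proof.
move=> K0 H; apply/eqP; rewrite -normr_le0 real_leNgt ?normr_real ?real0 //.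
apply/negP => x0.
have K1 : 0 < K + 1 by rewrite ltr_wpDl.
have := H (`|x| / (K + 1)) (divr_gt0 x0 K1).
rewrite mulrAC ler_pdivlMr // mulrDr mulr1 -subr_ge0 => h.
have : `|x| * K - (`|x| * K + `|x|) = - `|x| by ring.
by move=> E; move: h; rewrite E oppr_ge0 => /(lt_le_trans x0); rewrite ltxx.
Qed.

Section FormOnSpans.

Variables (C : numClosedFieldType) (A : comNzRingType) (iota : {rmorphism C -> A}).
Variable B : A -> A -> C.
Hypothesis hB : hermitian_form iota B.
Variables z w : A.
Local Notation span := (mspan iota z w).
Local Notation "'e[ i , j ]" := (z ^+ i * w ^+ j) (format "''e[' i ,  j ]").

Lemma span_orthl S f g :
  span S f -> (forall i j, S i j -> B 'e[i, j] g = 0) -> B f g = 0.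
Proof.
move=> Sf Sg; elim: Sf => [|i j a f' Sij _ IH]; first by rewrite (form0l hB).
by rewrite (formDl hB) (formZl hB) Sg // IH mulr0 addr0.
Qed.

Lemma span_orthr S f g :
  span S g -> (forall i j, S i j -> B f 'e[i, j] = 0) -> B f g = 0.
Proof.
move=> Sg Sf; apply: (form_eq0C hB); apply: (span_orthl Sg) => i j Sij.
by apply: (form_eq0C hB); apply: Sf.
Qed.

Hypothesis Bz : forall f g, B (z * f) (z * g) = B f g.
Hypothesis Bw : forall f g, B (w * f) (w * g) = B f g.

Lemma form_shift a b f g : B ('e[a, b] * f) ('e[a, b] * g) = B f g.
Proof.
have Hz k x y : B (z ^+ k * x) (z ^+ k * y) = B x y.
  by elim: k x y => [|k IH] x y; rewrite ?expr0 ?mul1r // exprS -!mulrA Bz IH.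
have Hw k x y : B (w ^+ k * x) (w ^+ k * y) = B x y.
  by elim: k x y => [|k IH] x y; rewrite ?expr0 ?mul1r // exprS -!mulrA Bw IH.
by rewrite -!mulrA Hz Hw.
Qed.

End FormOnSpans.

(** * Orthogonality and the dual basis in [z], with coefficients polynomial in [w] *)

Section Slice.

Variables (C : numClosedFieldType) (A : comNzRingType) (iota : {rmorphism C -> A}).
Variable B : A -> A -> C.
Hypothesis hB : hermitian_form iota B.
Variables z w : A.
Hypothesis Bz : forall f g, B (z * f) (z * g) = B f g.
Hypothesis Bw : forall f g, B (w * f) (w * g) = B f g.
Local Notation span := (mspan iota z w).
Local Notation "'e[ i , j ]" := (z ^+ i * w ^+ j) (format "''e[' i ,  j ]").
Local Notation norm := (fnorm B).
Let shift := form_shift Bz Bw.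

Variables (n m : nat) (P R : nat -> A).
Hypothesis spanP : forall l, span (fun i j => (i == 0)%N && (j <= m)%N) (P l).
Hypothesis spanR : forall l, span (fun i j => (i == 0)%N && (j <= m)%N) (R l).
(** On the torus [R l] is [w^m] times the conjugate of [P l]. As [A] carries no conjugation, the
    relation is expressed through the form. *)
Hypothesis adjR : forall l f g, B f (R l * g) = B (P l * f) (w ^+ m * g).
Let p := \sum_(l < n.+1) P l * z ^+ l.
Let q := \sum_(l < n.+1) R l * z ^+ (n - l).
Hypothesis orthoP : forall k l a b,
  B (p * 'e[k, l]) (p * 'e[a, b]) = ((k == a) && (l == b))%:R.
Hypothesis approx_inv : forall e : C, 0 < e -> exists d r,
  span (fun i j => (i <= d)%N && (j <= d)%N) r /\ norm (1 - p * r) <= e.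
Hypothesis approx_inv0 : forall e : C, 0 < e -> exists r,
  span (fun i j => (i == 0)%N) r /\ norm (1 - P 0 * r) <= e.

Lemma norm_shift k l f : norm ('e[k, l] * f) = norm f.
Proof. by rewrite /fnorm shift. Qed.

Lemma norm_mon k l : norm 'e[k, l] = norm 1.
Proof. by rewrite -[X in norm X]mulr1 norm_shift. Qed.

Lemma norm_p_mon k l : norm (p * 'e[k, l]) = 1.
Proof. by rewrite /fnorm orthoP !eqxx sqrtC1. Qed.

(** Up to a small error [1] is replaced by [p * r]. Then [z^k w^l p r] is a combination of
    [p z^x w^y] with [x >= k] and [y >= l]; the index [(a, b)] is not among them, and [orthoP]
    applies. *)
Lemma orth_p k l a b : (a < k)%N || (b < l)%N -> B 'e[k, l] ('e[a, b] * p) = 0.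
Proof.
move=> ab; apply: (small_eq0 ler01) => e e0; rewrite mulr1.
have [d [r [Sr r_e]]] := approx_inv e0.
have -> : 'e[k, l] = 'e[k, l] * (1 - p * r) + p * ('e[k, l] * r) by ring.
rewrite (formDl hB).
have -> : B (p * ('e[k, l] * r)) ('e[a, b] * p) = 0.
  elim: Sr => [|i j x f _ _ IH]; first by rewrite !mulr0 (form0l hB).
  rewrite !mulrDr (formDl hB) {}IH addr0.
  have -> : p * ('e[k, l] * (iota x * 'e[i, j])) =
    iota x * (p * 'e[k + i, l + j]) by rewrite !exprD; ring.
  rewrite (formZl hB) ['e[a, b] * p]mulrC orthoP.
  by case: eqP => [?|_]; case: eqP => [?|_] /=; rewrite ?mulr0 //; lia.
rewrite addr0; apply: (le_trans (form_CS hB _ _)).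
by rewrite norm_shift ['e[a, b] * p]mulrC norm_p_mon mulr1.
Qed.

Lemma formRz f g l : (l <= n)%N ->
  B f (R l * z ^+ (n - l) * g) = B (P l * z ^+ l * f) ('e[n, m] * g).
Proof.
move=> ln; rewrite -mulrA adjR -(shift l 0) expr0 !mulr1.
congr (B _ _); first by ring.
by rewrite -{2}(subnKC ln) exprD; ring.
Qed.

(** In terms of the form, [q] is [z^n w^m] times the conjugate of [p]; this transfers orthogonality
    from [p] to [q]. *)
Lemma form_q f g : B f (q * g) = B (p * f) ('e[n, m] * g).
Proof.
rewrite !mulr_suml (form_sumr hB) (form_suml hB).
by apply: eq_bigr => l _; rewrite formRz // -ltnS.
Qed.

Lemma norm_q : B q q = 1.
Proof.
rewrite -[X in B _ X]mulr1 form_q mulr1 (formC hB).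
have -> : B 'e[n, m] (p * q) = B 'e[n, m] (q * p) by congr (B _ _); apply: mulrC.
rewrite form_q.
by rewrite ['e[n, m] * p]mulrC orthoP !eqxx rmorph1.
Qed.

Lemma orth_q k l a b : (k < a + n)%N || (l < b + m)%N -> B 'e[k, l] ('e[a, b] * q) = 0.
Proof.
move=> kl; rewrite ['e[a, b] * q]mulrC form_q; apply: (form_eq0C hB).
have -> : 'e[n, m] * 'e[a, b] = 'e[a + n, b + m] by rewrite !exprD; ring.
by rewrite [p * _]mulrC; apply: orth_p.
Qed.

(** A Riemann-Lebesgue statement in [w], uniform in the power of [z]: [z^a w^b] is close to
    [z^a w^b r p], a combination of [z^x w^y p] with [y] bounded, and these are orthogonal to
    [z^i w^k] for larger [k] by [orth_p]. *)
Lemma decay_mon a b (e : C) : 0 < e -> exists N, forall k i, (N <= k)%N ->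
  `|B 'e[a, b] 'e[i, k]| <= e.
Proof.
move=> e0.
have K0 : 0 < norm 1 + 1 by rewrite ltr_wpDl // (fnorm_ge0 hB).
have [d [r [Sr r_e]]] := approx_inv (divr_gt0 e0 K0).
exists (b + d.+1)%N => k i Nk.
have -> : 'e[a, b] = 'e[a, b] * (1 - p * r) + 'e[a, b] * r * p by ring.
rewrite (formDl hB).
have -> : B ('e[a, b] * r * p) 'e[i, k] = 0.
  apply: (form_eq0C hB); elim: Sr => [|x y c f /andP[xd yd] _ IH].
    by rewrite mulr0 mul0r (form0r hB).
  rewrite mulrDr mulrDl (formDr hB) {}IH addr0.
  have -> : 'e[a, b] * (iota c * 'e[x, y]) * p =
    iota c * ('e[a + x, b + y] * p) by rewrite !exprD; ring.
  by rewrite (formZr hB) orth_p ?mulr0 //; apply/orP; right; lia.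
rewrite addr0; apply: (le_trans (form_CS hB _ _)).
rewrite norm_shift norm_mon.
have := ler_wpM2r (fnorm_ge0 hB 1) r_e; move/le_trans; apply.
by rewrite mulrAC ler_pdivrMr // ler_wpM2l ?(ltW e0) // lerDl.
Qed.

Lemma decay S f (e : C) : span S f -> 0 < e -> exists N, forall k i, (N <= k)%N ->
  `|B f 'e[i, k]| <= e.
Proof.
move=> Sf; elim: Sf e => [|a b c f' _ _ IH] e e0.
  by exists 0%N => k i _; rewrite (form0l hB) normr0 ltW.
have e2 : 0 < e / 2 by rewrite divr_gt0.
have [N1 H1] := IH _ e2.
have c1 : 0 < `|c| + 1 by rewrite ltr_wpDl.
have [N2 H2] := decay_mon a b (divr_gt0 e2 c1).
exists (maxn N1 N2) => k i; rewrite geq_max => /andP[k1 k2].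
rewrite (formDl hB) (formZl hB); apply: (le_trans (ler_normD _ _)).
rewrite [X in _ <= X](splitr e) lerD ?H1 // normrM.
apply: (le_trans (ler_wpM2l (normr_ge0 _) (H2 k i k2))).
rewrite mulrCA -[X in _ <= X]mulr1 ler_wpM2l ?(ltW e2) // ler_pdivrMr // mul1r.
by rewrite lerDl.
Qed.

(** At fixed [w] of modulus one, this is [w^m] times the coefficient of [(conj s)^i] in the
    Christoffel-Darboux quotient [(p(z) conj p(s) - q(z) conj q(s)) / (1 - z conj s)]. The factor
    [w^m] turns the conjugates of [P a] and [R b] into [R a] and [P b]. *)
Definition dual i : A :=
  \sum_(a < n.+1 | (a <= i)%N) z ^+ (i - a) * p * R a -
  \sum_(b < n.+1 | (n - i <= b)%N) z ^+ (i - (n - b)) * q * P b.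

(** The terms with [q] vanish by [orth_q] because [k < n]. In the terms with [p], moving [R a] to
    the left gives [P a z^a] there; the missing indices [a > i] would contribute zero by [orth_p],
    so the sum completes to [p] and [orthoP] evaluates it. The shift by [m] comes from the factor
    [w^m] in [dual]. *)
Lemma form_dual i k l t : (i < n)%N -> (k < n)%N ->
  B 'e[k, l] (w ^+ t * dual i) = ((k == i) && (l == t + m)%N)%:R.
Proof.
move=> i_n k_n; rewrite mulrBr (formBr hB) !mulr_sumr !(form_sumr hB).
rewrite [X in _ - X]big1 ?subr0; last first => [b _|].
  have -> : w ^+ t * (z ^+ (i - (n - b)) * q * P b) =
     P b * ('e[i - (n - b), t] * q) by ring.
  elim: (spanP b) => [|x y c f _ _ IH]; first by rewrite mul0r (form0r hB).
  rewrite mulrDl (formDr hB) {}IH addr0.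
  set e := (i - _)%N.
  have -> : iota c * 'e[x, y] * ('e[e, t] * q) = iota c * ('e[x + e, y + t] * q).
    by rewrite !exprD; ring.
  by rewrite (formZr hB) orth_q ?mulr0 //; apply/orP; left; lia.
transitivity (\sum_(a < n.+1) B (P a * z ^+ a * 'e[k, l]) (p * 'e[i, t + m])).
  rewrite [RHS](bigID (fun a : 'I_n.+1 => (a <= i)%N)) /= [X in _ + X]big1 ?addr0.
    apply: eq_bigr => a ai.
    have -> : w ^+ t * (z ^+ (i - a) * p * R a) = R a * ('e[i - a, t] * p) by ring.
    rewrite adjR -(shift a 0) expr0 !mulr1; congr (B _ _); first by ring.
    by rewrite -[in RHS](subnKC ai) !exprD; ring.
  move=> a ai; rewrite -mulrA; elim: (spanP a) => [|x y c f _ _ IH].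
    by rewrite mul0r (form0l hB).
  rewrite mulrDl (formDl hB) {}IH addr0.
  have -> : iota c * 'e[x, y] * (z ^+ a * 'e[k, l]) = iota c * 'e[x + a + k, y + l].
    by rewrite !exprD; ring.
  rewrite (formZl hB) [p * _]mulrC orth_p ?mulr0 //.
  by apply/orP; left; move: ai; rewrite -ltnNge; lia.
by rewrite -(form_suml hB) -mulr_suml orthoP.
Qed.

(** This reflects the divisibility of the Christoffel-Darboux numerator by [1 - z conj s]: once both
    sums are written in the products [P b * R a * z^k], the high powers of [z] cancel. *)
Lemma span_dual i : (i < n)%N ->
  span (fun k j => (k < n)%N && (j <= 2 * m)%N) (dual i).
Proof.
move=> i_n.
have PR a b k : (k < n)%N -> span (fun k j => (k < n)%N && (j <= 2 * m)%N) (P b * R a * z ^+ k).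
  move=> kn; have -> : P b * R a * z ^+ k = 'e[k, 0] * (P b * R a).
    by rewrite expr0 mulr1 mulrC.
  apply: (@span_shift _ _ _ _ _ (fun i j => (i == 0)%N && (j <= 2 * m)%N)).
    by move=> x y /andP[/eqP-> y2]; lia.
  by apply: (spanM _ (spanP b) (spanR a)) => x y x' y'; lia.
rewrite /dual.
have -> : \sum_(a < n.+1 | (a <= i)%N) z ^+ (i - a) * p * R a =
  \sum_(a < n.+1) \sum_(b < n.+1)
     (if (a <= i)%N then P b * R a * z ^+ (i - a + b) else 0).
  rewrite big_mkcond; apply: eq_bigr => a _; case: ifP => _; last by rewrite big1.
  rewrite /p mulr_sumr mulr_suml; apply: eq_bigr => b _.
  by rewrite exprD; ring.
have -> : \sum_(b < n.+1 | (n - i <= b)%N) z ^+ (i - (n - b)) * q * P b =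
  \sum_(a < n.+1) \sum_(b < n.+1)
     (if (n - i <= b)%N then P b * R a * z ^+ (i - (n - b) + (n - a)) else 0).
  rewrite exchange_big big_mkcond; apply: eq_bigr => b _.
  case: ifP => _; last by rewrite big1.
  rewrite /q mulr_sumr mulr_suml; apply: eq_bigr => a _.
  by rewrite exprD; ring.
(* The pairs with [a <= i] and [n - i <= b] cancel; the other terms have z-degree below n. *)
rewrite -sumrB; apply: span_sum => -[a an] _; rewrite -sumrB.
apply: span_sum => -[b bn] _ /=.
case: ifP => ai; case: ifP => bi.
- have -> : (i - (n - b) + (n - a) = i - a + b)%N by lia.
  by rewrite subrr; apply: mspan0.
- by rewrite subr0; apply: PR; lia.
- by rewrite sub0r; apply: spanN; apply: PR; lia.
by rewrite subr0; apply: mspan0.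
Qed.


Section Orthogonal.

Variable g : A.
Hypothesis Sg : span (fun i j => (i < n)%N && (j <= m)%N) g.
Hypothesis g_orth : forall i j, (i < n)%N -> (0 < j <= m)%N -> B g 'e[i, j] = 0.

Let h i k := B g 'e[i, k].
Let u N := \sum_(i < n) \sum_(m.+1 <= k < N.+1) iota (h i k) * (w ^+ (k - m) * dual i).

Lemma form_u N i k : (i < n)%N ->
  B (u N) 'e[i, k] = if (m < k <= N)%N then h i k else 0.
Proof.
move=> i_n; rewrite (form_suml hB) (bigD1 (Ordinal i_n)) //= [X in _ + X]big1 ?addr0.
  rewrite (form_suml hB).
  rewrite (eq_big_nat _ _ (F2 := fun k' => if k' == k then h i k else 0)); last first.
    move=> k' /andP[mk' _]; rewrite (formZl hB) (formC hB) form_dual // eqxx subnK ?(ltnW mk') //.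
    by rewrite conjC_nat /= eq_sym; case: eqP => [->|_]; rewrite ?mulr1 ?mulr0.
  by rewrite -big_mkcond big_nat1_eq.
move=> j ij; rewrite (form_suml hB) big1_seq // => k' /andP[_ _].
rewrite (formZl hB) (formC hB) form_dual //.
have -> : (i == j :> nat) = false.
  by apply/negP => /eqP e; move: ij; rewrite -val_eqE /= e eqxx.
by rewrite conjC_nat mulr0.
Qed.

(** Pairing with [w^(k - m) * dual i] reads off the coefficient at [z^i w^k], and [g] has degree at
    most [m] in [w]. *)
Lemma form_g_dual i k : (i < n)%N -> (m < k)%N -> B g (w ^+ (k - m) * dual i) = 0.
Proof.
move=> i_n mk; apply: (span_orthl hB Sg) => a b /andP[an bm].
rewrite form_dual //; case: (_ =P (_ + _)%N) => [|_]; last by rewrite andbF.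
by lia.
Qed.

(** The exponents of [w] in [w^(k - m) * dual i] lie between [k - m] and [k + m], hence between [1]
    and [N]. There [u N] and [g] have equal moments: up to [m] both vanish, beyond [m] they agree by
    [form_u]. *)
Lemma form_u_dual N i k : (i < n)%N -> (m < k)%N -> (k + m <= N)%N ->
  B (u N) (w ^+ (k - m) * dual i) = 0.
Proof.
move=> i_n mk kN; rewrite -(form_g_dual i_n mk); apply/eqP; rewrite -subr_eq0 -(formBl hB).
have Sd : span (fun i j => (i < n)%N && (0 < j <= N)%N) (w ^+ (k - m) * dual i).
  rewrite -[w ^+ _]mul1r -(expr0 z); apply: span_shift (span_dual i_n) => x y; lia.
apply/eqP; apply: (span_orthr hB Sd) => a b /andP[an bN].
rewrite (formBl hB) form_u //; case: ifP => mb; first by rewrite subrr.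
by rewrite g_orth ?subrr //; lia.
Qed.

Lemma orth_far i j : (i < n)%N -> (0 < j)%N -> B g 'e[i, j] = 0.
Proof.
move=> i_n j0; have [jm|mj] := leqP j m; first by apply: g_orth; rewrite ?j0.
pose K := \sum_(i < n) norm (dual i).
have K0 : 0 <= K by apply: sumr_ge0 => ? _; apply: (fnorm_ge0 hB).
apply: (@small_eq0 _ _ (n%:R * m%:R * K * norm 1)) => [|e e0].
  by rewrite !mulr_ge0 ?ler0n ?(fnorm_ge0 hB).
have [N0 HN0] := decay Sg e0.
(* [N >= j] makes [u N] keep the moment in question, [N >= 2 * m] allows the sum to be split at
   [N - m], and every [k > N - m] exceeds [N0], so that its moment is at most [e]. *)
pose N := (j + N0 + 2 * m)%N.
have -> : B g 'e[i, j] = B (u N) 'e[i, j].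
  by rewrite form_u // ifT //; rewrite /N; lia.
apply: (le_trans (form_CS hB _ _)); rewrite norm_mon mulrA.
apply: ler_wpM2r; first exact: (fnorm_ge0 hB).
set x := norm (u N).
have x0 : 0 <= x by apply: (fnorm_ge0 hB).
(* Either [x = 0] or a factor [x] can be cancelled, which bounds the norm of [u N] by a multiple of
   [e]. *)
suff : x * x <= x * (e * (n%:R * m%:R * K)).
  move: x0; rewrite le_eqVlt => /orP[/eqP <- _|x0]; last by rewrite ler_pM2l.
  by rewrite !mulr_ge0 ?ler0n ?(ltW e0).
have -> : x * x = `|B (u N) (u N)|.
  by rewrite ger0_norm ?(form_ge0 hB) // -(fnormK B) expr2.
rewrite {2}/u (form_sumr hB); apply: (le_trans (ler_norm_sum _ _ _)).
have -> : x * (e * (n%:R * m%:R * K)) = \sum_(i < n) (m%:R * (e * (x * K))).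
  by rewrite sumr_const card_ord -mulr_natl; ring.
apply: ler_sum => -[a an] _ /=.
rewrite (form_sumr hB).
(* The terms with [k <= N - m] vanish by [form_u_dual]; the [m] terms near [N] remain. *)
rewrite (@big_cat_nat _ _ _ (N - m).+1) /=; [|by rewrite /N; lia|by rewrite /N; lia].
rewrite [X in `|X + _|]big_nat_cond [X in `|X + _|]big1 ?add0r; last first.
  move=> k; rewrite andbT => /andP[mk kN].
  by rewrite (formZr hB) form_u_dual ?mulr0 //; move: kN; rewrite /N; lia.
apply: (le_trans (ler_norm_sum _ _ _)).
have -> : m%:R * (e * (x * K)) = \sum_((N - m).+1 <= k < N.+1) (e * (x * K)).
  rewrite sumr_const_nat mulr_natl; congr (_ *+ _); rewrite /N; lia.
rewrite big_nat_cond [X in _ <= X]big_nat_cond; apply: ler_sum => k.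
rewrite andbT => /andP[kN _]; rewrite (formZr hB) normrM norm_conjC.
apply: ler_pM => //; first by apply: HN0; move: kN; rewrite /N; lia.
apply: (le_trans (form_CS hB _ _)); apply: ler_wpM2l => //.
rewrite -[w ^+ _]mul1r -(expr0 z) norm_shift.
rewrite /K (bigD1 (Ordinal an)) //= lerDl.
by apply: sumr_ge0 => ? _; apply: (fnorm_ge0 hB).
Qed.

(** [w^j] is close to [w^j P_0 r] with [r] in [w] alone, and [P_0] is [p] minus a multiple of [z].
    The part with [p] is orthogonal to [z * g] by [orth_p], as [z * g] has only positive powers of
    [z]; in the other part a factor [z] cancels and [orth_far] applies. *)
Lemma orth_shifted j : (0 < j)%N -> B (z * g) (w ^+ j) = 0.
Proof.
move=> j0; apply: (@small_eq0 _ _ (norm (z * g))) => [|e e0].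
  exact: (fnorm_ge0 hB).
have [r [Sr r_e]] := approx_inv0 e0.
have -> : w ^+ j = 'e[0, j] * (1 - P 0 * r) + 'e[0, j] * (P 0 * r).
  by rewrite expr0; ring.
rewrite (formDr hB).
have -> : B (z * g) ('e[0, j] * (P 0 * r)) = 0.
  have -> : 'e[0, j] * (P 0 * r) = 'e[0, j] * r * p -
      z * ('e[0, j] * r * \sum_(l < n) P l.+1 * z ^+ l).
    rewrite /p big_ord_recl expr0 mulr1 [z * _]mulrCA mulr_sumr mulrDr.
    rewrite (eq_bigr (fun i : 'I_n => z * (P i.+1 * z ^+ i))) => [|l _].
      by ring.
    by rewrite lift0 exprS; ring.
  rewrite (formBr hB) Bz [X in _ - X](_ : _ = 0) ?subr0.
    apply: (@form_eq0C _ _ _ _ hB); elim: Sr => [|x y c f /eqP-> _ IH].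
      by rewrite mulr0 mul0r (form0l hB).
    rewrite mulrDr mulrDl (formDl hB) {}IH addr0.
    have -> : 'e[0, j] * (iota c * 'e[0, y]) * p = iota c * ('e[0, j + y] * p).
      by rewrite !exprD !expr0; ring.
    rewrite (formZl hB); apply/eqP; rewrite mulf_eq0; apply/orP; right; apply/eqP.
    apply: (form_eq0C hB).
    have Szg : span (fun i _ => (0 < i)%N) (z * g).
      have -> : z * g = 'e[1, 0] * g by rewrite expr1 expr0 mulr1.
      by apply: span_shift Sg => a b; lia.
    by apply: (span_orthl hB Szg) => a b a0; rewrite orth_p ?a0.
  rewrite mulr_sumr (form_sumr hB) big1 // => -[l ln] _ /=.
  have S2 : span (fun i j => (i < n)%N && (0 < j)%N) ('e[0, j] * r * (P l.+1 * z ^+ l)).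
    have -> : 'e[0, j] * r * (P l.+1 * z ^+ l) = 'e[l, j] * (r * P l.+1).
      by rewrite expr0; ring.
    apply: (@span_shift _ _ _ _ _ (fun i j => (i == 0)%N)).
      by move=> a b /eqP->; lia.
    by apply: (spanM _ Sr (spanP l.+1)) => a b c d; lia.
  by apply: (span_orthr hB S2) => a b /andP[an b0]; apply: orth_far.
rewrite addr0; apply: (le_trans (form_CS hB _ _)); rewrite mulrC.
by rewrite norm_shift ler_wpM2r ?(fnorm_ge0 hB).
Qed.

End Orthogonal.

End Slice.

Section MoreSpans.

Variables (C : numClosedFieldType) (A : comNzRingType) (iota : {rmorphism C -> A}).
Variables z w : A.

Lemma span_swap S f : mspan iota z w S f -> mspan iota w z (fun i j => S j i) f.
Proof.
elim=> [|i j a f' Sij _ IH]; first exact: mspan0.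
by rewrite [_ ^+ i * _]mulrC; apply: mspan_cons.
Qed.

Lemma span_coef (N M : nat) f : mspan iota z w (fun i j => (i < N)%N && (j < M)%N) f ->
  exists c : nat -> nat -> C,
    f = \sum_(i < N) \sum_(j < M) iota (c i j) * (z ^+ i * w ^+ j).
Proof.
elim=> [|i j a f' /andP[iN jM] _ [c ->]].
  by exists (fun _ _ => 0); rewrite big1 // => i _; rewrite big1 // => j _; rewrite rmorph0 mul0r.
exists (fun k l => (if (k == i) && (l == j) then a else 0) + c k l).
under [RHS]eq_bigr => k _ do under eq_bigr => l _ do rewrite rmorphD mulrDl.
under [RHS]eq_bigr => k _ do rewrite big_split.
rewrite big_split; congr (_ + _).
rewrite (bigD1 (Ordinal iN)) //= (bigD1 (Ordinal jM)) //= !eqxx.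
rewrite big1 => [|l]; last first.
  by rewrite -val_eqE /= => /negPf->; rewrite rmorph0 mul0r.
rewrite big1 => [|k]; first by rewrite !addr0.
by rewrite -val_eqE /= => /negPf->; rewrite big1 // => l _; rewrite rmorph0 mul0r.
Qed.

End MoreSpans.

(** * Finite orthonormal families, projections and kernels *)

Section LinearCombinations.

Variables (C : numClosedFieldType) (A : comNzRingType) (iota : {rmorphism C -> A}).

(** An arbitrary finite index type lets several families be joined through a sum type. *)
Definition lincomb (T : finType) (v : T -> A) f :=
  exists a : T -> C, f = \sum_t iota (a t) * v t.

Variables (T : finType) (v : T -> A).

Lemma lincombD f g : lincomb v f -> lincomb v g -> lincomb v (f + g).
Proof.
move=> [a ->] [b ->]; exists (fun t => a t + b t); rewrite -big_split.
by apply: eq_bigr => t _; rewrite rmorphD mulrDl.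
Qed.

Lemma lincombZ x f : lincomb v f -> lincomb v (iota x * f).
Proof.
move=> [a ->]; exists (fun t => x * a t); rewrite mulr_sumr.
by apply: eq_bigr => t _; rewrite rmorphM mulrA.
Qed.

Lemma lincomb_mem t : lincomb v (v t).
Proof.
exists (fun s => (s == t)%:R); rewrite (bigD1 t) //= eqxx rmorph1 mul1r.
by rewrite big1 ?addr0 // => s /negPf->; rewrite rmorph0 mul0r.
Qed.

Lemma lincomb0 : lincomb v 0.
Proof. by exists (fun=> 0); rewrite big1 // => t _; rewrite rmorph0 mul0r. Qed.

Lemma lincomb_trans (T' : finType) (v' : T' -> A) x f :
  (forall t, lincomb v (x * v' t)) -> lincomb v' f -> lincomb v (x * f).
Proof.
move=> H [a ->]; rewrite mulr_sumr; apply: big_ind.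
- exact: lincomb0.
- exact: lincombD.
- by move=> t _; rewrite mulrCA; apply: lincombZ.
Qed.

Variable B : A -> A -> C.
Hypothesis hB : hermitian_form iota B.

Definition orthonormal := forall s t, B (v s) (v t) = (s == t)%:R.

Lemma lincomb_coef f : orthonormal -> lincomb v f ->
  f = \sum_t iota (B f (v t)) * v t.
Proof.
move=> ov [a ->]; apply: eq_bigr => t _; congr (iota _ * _).
rewrite (form_suml hB) (bigD1 t) //= (formZl hB) ov eqxx mulr1.
by rewrite big1 ?addr0 // => s /negPf st; rewrite (formZl hB) ov st mulr0.
Qed.

(** Gram-Schmidt for a form that may have null vectors. The last conclusion serves the induction: a
    residue orthogonal to [s] is also orthogonal to the projection [r0] of the new vector, so only
    [r] has to be corrected. *)
Lemma projection_exists (Q : A -> Prop) (s : seq A) f :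
  (forall g h, Q g -> Q h -> Q (g + h)) -> (forall a g, Q g -> Q (iota a * g)) ->
  Q 0 -> (forall g, g \in s -> Q g) ->
  exists g, [/\ Q g, forall h, h \in s -> B (f - g) h = 0 &
    forall k, (forall h, h \in s -> B k h = 0) -> B k g = 0].
Proof.
move=> QD QZ Q0; elim: s f => [|h s IH] f Qs.
  by exists 0; split=> // k _; rewrite (form0r hB).
have Qs' g : g \in s -> Q g by move=> gs; apply: Qs; rewrite inE gs orbT.
have [g0 [Qg0 og0 kg0]] := IH f Qs'.
have [r0 [Qr0 or0 kr0]] := IH h Qs'.
pose r := h - r0; pose a := B (f - g0) r / B r r.
have Qr : Q r.
  apply: QD; first by apply: Qs; rewrite inE eqxx.
  by rewrite -mulN1r -(rmorphN1 iota); apply: QZ.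
exists (g0 + iota a * r); split.
- by apply: QD => //; apply: QZ.
- have os h' : h' \in s -> B (f - (g0 + iota a * r)) h' = 0.
    move=> h's; rewrite opprD addrA (formBl hB) og0 // (formZl hB) or0 //.
    by rewrite mulr0 subr0.
  move=> h'; rewrite inE => /orP[/eqP->|]; last exact: os.
  have -> : h = r + r0 by rewrite subrK.
  rewrite (formDr hB) [X in _ + X]kr0 // addr0 opprD addrA (formBl hB) (formZl hB).
  (* If [r] is a null vector nothing has to be corrected, since [form_null] makes it orthogonal to
     everything. *)
  have [r0'|rn0] := eqVneq (B r r) 0; last by rewrite /a divfK // subrr.
  by rewrite r0' mulr0 subr0; apply: (form_eq0C hB); apply: (form_null hB).
move=> k kh; have ks h' : h' \in s -> B k h' = 0.
  by move=> h's; apply: kh; rewrite inE h's orbT.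
rewrite (formDr hB) kg0 // (formZr hB) (formBr hB) kr0 // kh ?inE ?eqxx //.
by rewrite subr0 mulr0 addr0.
Qed.

End LinearCombinations.

(** Each family is expanded in the other. The two coefficient matrices are adjoint to each other, so
    the double sums coincide. The morphisms [phi] and [psi] stand for evaluations at two points. *)
Lemma eq_kernel (C : numClosedFieldType) (A : comNzRingType) (iota : {rmorphism C -> A})
    (B : A -> A -> C) (S T : finType) (u : S -> A) (v : T -> A)
    (phi psi : {rmorphism A -> C}) :
  hermitian_form iota B -> cancel iota phi -> cancel iota psi ->
  orthonormal u B -> orthonormal v B ->
  (forall t, lincomb iota u (v t)) -> (forall s, lincomb iota v (u s)) ->
  \sum_s phi (u s) * (psi (u s))^* = \sum_t phi (v t) * (psi (v t))^*.
Proof.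
move=> hB phiK psiK ou ov vu uv.
under eq_bigr => s _.
  rewrite {1}(lincomb_coef hB ov (uv s)) rmorph_sum mulr_suml.
  under eq_bigr => t _ do rewrite rmorphM phiK.
  over.
rewrite exchange_big; apply: eq_bigr => t _.
have -> : psi (v t) = \sum_s B (v t) (u s) * psi (u s).
  rewrite {1}(lincomb_coef hB ou (vu t)) rmorph_sum.
  by apply: eq_bigr => s _; rewrite rmorphM psiK.
rewrite rmorph_sum mulr_sumr; apply: eq_bigr => s _.
by rewrite rmorphM /= -(formC hB); ring.
Qed.

(** * Orthogonality in both variables and the two orthonormal bases *)

Section CoefficientPolynomials.

Variables (C : numClosedFieldType) (A : comNzRingType) (iota : {rmorphism C -> A}).

Definition upoly (x : A) m (d : nat -> C) := \sum_(j < m.+1) iota (d j) * x ^+ j.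
Definition rpoly (x : A) m (d : nat -> C) := \sum_(j < m.+1) iota (d j)^* * x ^+ (m - j).

Variables z w : A.

Lemma span_upoly m d : mspan iota z w (fun i j => (i == 0)%N && (j <= m)%N) (upoly w m d).
Proof.
apply: span_sum => j _; rewrite -[w ^+ j]mul1r -(expr0 z); apply: spanZ.
by apply: span_mon; rewrite eqxx -ltnS ltn_ord.
Qed.

Lemma span_rpoly m d : mspan iota z w (fun i j => (i == 0)%N && (j <= m)%N) (rpoly w m d).
Proof.
apply: span_sum => j _; rewrite -[w ^+ _]mul1r -(expr0 z); apply: spanZ.
by apply: span_mon; rewrite eqxx leq_subr.
Qed.

Variable B : A -> A -> C.
Hypothesis hB : hermitian_form iota B.
Hypothesis Bz : forall f g, B (z * f) (z * g) = B f g.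
Hypothesis Bw : forall f g, B (w * f) (w * g) = B f g.

(** This supplies [adjR] for the slices of [p]: the conjugate coefficients leave the second
    argument, and multiplying both arguments by [w^j] restores the exponents. *)
Lemma form_rpoly m d f g : B f (rpoly w m d * g) = B (upoly w m d * f) (w ^+ m * g).
Proof.
rewrite !mulr_suml (form_sumr hB) (form_suml hB); apply: eq_bigr => j _.
rewrite -!mulrA (formZr hB) (formZl hB) conjCK.
rewrite -(form_shift Bz Bw 0 j) expr0 !mul1r; congr (_ * B _ _).
by rewrite mulrA -exprD subnKC // -ltnS.
Qed.

End CoefficientPolynomials.

Section Bidisk.

Variables (C : numClosedFieldType) (A : comNzRingType) (iota : {rmorphism C -> A}).
Variable B : A -> A -> C.
Hypothesis hB : hermitian_form iota B.
Variables z w : A.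
Hypothesis Bz : forall f g, B (z * f) (z * g) = B f g.
Hypothesis Bw : forall f g, B (w * f) (w * g) = B f g.
Local Notation span := (mspan iota z w).
Local Notation "'e[ i , j ]" := (z ^+ i * w ^+ j) (format "''e[' i ,  j ]").
Local Notation norm := (fnorm B).

Variables (n m : nat) (c : nat -> nat -> C).
Definition dpoly := \sum_(i < n.+1) \sum_(j < m.+1) iota (c i j) * 'e[i, j].
Definition dtilde := \sum_(i < n.+1) \sum_(j < m.+1) iota (c i j)^* * 'e[n - i, m - j].
Local Notation p := dpoly.
Local Notation q := dtilde.

Hypothesis c00 : c 0 0 != 0.
Hypothesis orthoP : forall k l a b,
  B (p * 'e[k, l]) (p * 'e[a, b]) = ((k == a) && (l == b))%:R.
Hypothesis approx_inv : forall e : C, 0 < e -> exists d r,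
  span (fun i j => (i <= d)%N && (j <= d)%N) r /\ norm (1 - p * r) <= e.
Hypothesis approx_invw : forall e : C, 0 < e -> exists r,
  span (fun i j => (i == 0)%N) r /\ norm (1 - upoly iota w m (c 0) * r) <= e.
Hypothesis approx_invz : forall e : C, 0 < e -> exists r,
  span (fun i j => (j == 0)%N) r /\ norm (1 - upoly iota z n (c^~ 0%N) * r) <= e.

Lemma dpolyEz : p = \sum_(l < n.+1) upoly iota w m (c l) * z ^+ l.
Proof.
apply: eq_bigr => i _; rewrite mulr_suml; apply: eq_bigr => j _.
by rewrite -mulrA [_ ^+ i * _]mulrC.
Qed.

Lemma dpolyEw : p = \sum_(l < m.+1) upoly iota z n (c^~ l) * w ^+ l.
Proof.
rewrite /dpoly exchange_big; apply: eq_bigr => i _.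
by rewrite mulr_suml; apply: eq_bigr => j _; rewrite -mulrA.
Qed.

Lemma dtildeEz : q = \sum_(l < n.+1) rpoly iota w m (c l) * z ^+ (n - l).
Proof.
apply: eq_bigr => i _; rewrite mulr_suml; apply: eq_bigr => j _.
by rewrite -mulrA [_ ^+ (n - i) * _]mulrC.
Qed.

Let Pz l := upoly iota w m (c l).
Let Rz l := rpoly iota w m (c l).
Let spanPz l : span _ (Pz l) := span_upoly iota z w m (c l).
Let spanRz l : span _ (Rz l) := span_rpoly iota z w m (c l).
Let adjRz l := form_rpoly hB Bz Bw m (c l).

Let orthoPz k l a b : B ((\sum_(l < n.+1) Pz l * z ^+ l) * 'e[k, l])
   ((\sum_(l < n.+1) Pz l * z ^+ l) * 'e[a, b]) = ((k == a) && (l == b))%:R.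
Proof. by rewrite -dpolyEz orthoP. Qed.

Let approx_invP (e : C) : 0 < e -> exists d r,
  span (fun i j => (i <= d)%N && (j <= d)%N) r /\
  norm (1 - (\sum_(l < n.+1) Pz l * z ^+ l) * r) <= e.
Proof. by rewrite -dpolyEz; apply: approx_inv. Qed.

Lemma dpoly_orth k l : (0 < k)%N || (0 < l)%N -> B 'e[k, l] p = 0.
Proof.
move=> kl; have := @orth_p _ _ _ _ hB z w Bz Bw n Pz orthoPz approx_invP k l 0 0 kl.
by rewrite -dpolyEz !expr0 !mul1r.
Qed.

Lemma dtilde_orth k l : (k < n)%N || (l < m)%N -> B 'e[k, l] q = 0.
Proof.
move=> kl.
have := @orth_q _ _ _ _ hB z w Bz Bw n m Pz Rz adjRz orthoPz approx_invP k l 0 0.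
by rewrite !add0n -dtildeEz !expr0 !mul1r; apply.
Qed.

Lemma dpoly_norm : B p p = 1.
Proof. by have := orthoP 0 0 0 0; rewrite !expr0 !mulr1. Qed.

Lemma dtilde_norm : B q q = 1.
Proof.
have := @norm_q _ _ _ _ hB z w Bz Bw n m Pz Rz adjRz orthoPz.
by rewrite -dtildeEz.
Qed.

Definition inH1 f := span (fun i j => (i <= n)%N && (j < m)%N) f /\
  forall i j, (i < n)%N -> (j < m)%N -> B f 'e[i, j] = 0.
Definition inH2 f := span (fun i j => (i < n)%N && (j <= m)%N) f /\
  forall i j, (i < n)%N -> (0 < j <= m)%N -> B f 'e[i, j] = 0.

Lemma H2_orth_shifted f j : inH2 f -> (0 < j)%N -> B (z * f) (w ^+ j) = 0.
Proof.
move=> [Sf of_] j0.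
by apply: (@orth_shifted _ _ _ _ hB z w Bz Bw n m Pz Rz spanPz spanRz adjRz orthoPz
   approx_invP approx_invw f Sf of_ j j0).
Qed.

(** The Toeplitz property of the moments. Equal differences of exponents are written as equal sums
    because subtraction truncates in [nat]. *)
Lemma form_mon_diff x y x' y' u v u' v' : (x + u' = u + x')%N -> (y + v' = v + y')%N ->
  B 'e[x, y] 'e[x', y'] = B 'e[u, v] 'e[u', v'].
Proof.
move=> xu yv; rewrite -(form_shift Bz Bw u' v') -[in RHS](form_shift Bz Bw x' y').
have E a b k l : 'e[a, b] * 'e[k, l] = 'e[a + k, b + l] by rewrite !exprD; ring.
by rewrite !E (addnC u') (addnC v') xu yv (addnC u) (addnC v) (addnC u') (addnC v').
Qed.

(** [f'] plays the part of [z^N w^M] times the conjugate of [f] on the torus and is characterized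
    through its pairings with monomials. *)
Lemma reflect_exists (N M : nat) f : span (fun i j => (i <= N)%N && (j <= M)%N) f ->
  exists f', span (fun i j => (i <= N)%N && (j <= M)%N) f' /\
  forall s t a b a' b', (N + s = a + a')%N -> (M + t = b + b')%N ->
    B ('e[s, t] * f') 'e[a', b'] = B 'e[a, b] f.
Proof.
elim=> [|i j x f0 /andP[iN jM] _ [f' [Sf' Hf']]].
  exists 0; split; first exact: mspan0.
  by move=> *; rewrite mulr0 (form0l hB) (form0r hB).
exists (iota x^* * 'e[N - i, M - j] + f'); split.
  by apply: mspan_cons => //; rewrite !leq_subr.
move=> s t a b a' b' Ns Mt.
rewrite mulrDr (formDl hB) (formDr hB) (Hf' _ _ a b) // mulrCA (formZl hB) (formZr hB).
have -> : 'e[s, t] * 'e[N - i, M - j] = 'e[s + (N - i), t + (M - j)].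
  by rewrite !exprD; ring.
by rewrite (@form_mon_diff _ _ a' b' a b i j) //; lia.
Qed.

(* Reflection [f |-> z^n w^(m-1) conj f] and the exchange of the variables turn this into [H2_orth_shifted]. *)
Lemma H1_orth f i : (0 < m)%N -> inH1 f -> (i < n)%N -> B f 'e[i, m] = 0.
Proof.
move=> m0 [Sf of_] i_n.
have [|f' [Sf' Hf']] := @reflect_exists n m.-1 f.
  by apply: span_le Sf => a b; lia.
apply: (form_eq0C hB).
(* Reflection turns [B (z^i w^m) f] into [B (w * f') (z^(n - i))]. *)
rewrite -(Hf' 0%N 1%N i m (n - i)%N 0%N) ?addn0 ?subnKC ?(ltnW i_n) //; last first.
  by rewrite addn1 prednK.
rewrite expr0 mul1r expr1 mulr1.
pose Pw l := upoly iota z n (c^~ l).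
pose Rw l := rpoly iota z n (c^~ l).
have orthoPw k l a b : B ((\sum_(l < m.+1) Pw l * w ^+ l) * (w ^+ k * z ^+ l))
   ((\sum_(l < m.+1) Pw l * w ^+ l) * (w ^+ a * z ^+ b)) = ((k == a) && (l == b))%:R.
  by rewrite -dpolyEw [w ^+ k * _]mulrC [w ^+ a * _]mulrC orthoP andbC.
have approxP (e : C) : 0 < e -> exists d r,
    mspan iota w z (fun i j => (i <= d)%N && (j <= d)%N) r /\
    norm (1 - (\sum_(l < m.+1) Pw l * w ^+ l) * r) <= e.
  move=> /approx_inv [d [r [Sr re]]]; exists d, r; rewrite -dpolyEw; split=> //.
  by apply: span_le (span_swap Sr) => a b; rewrite andbC.
have approx0 (e : C) : 0 < e -> exists r,
    mspan iota w z (fun i j => (i == 0)%N) r /\ norm (1 - Pw 0 * r) <= e.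
  move=> /approx_invz [r [Sr re]]; exists r; split=> //.
  exact: (span_swap Sr).
apply: (@orth_shifted _ _ _ _ hB w z Bw Bz m n Pw Rw
   (fun l => span_upoly iota w z n (c^~ l)) (fun l => span_rpoly iota w z n (c^~ l))
   (fun l => form_rpoly hB Bw Bz n (c^~ l)) orthoPw approxP approx0 f' _ _ (n - i)%N _).
- by apply: span_le (span_swap Sf') => a b; lia.
- move=> a b am /andP[b0 bn].
  have := Hf' 0%N 0%N (n - b)%N (m.-1 - a)%N b a.
  rewrite !expr0 !mul1r [w ^+ a * _]mulrC => ->; try lia.
  by apply: (form_eq0C hB); apply: of_; lia.
- by rewrite subn_gt0.
Qed.

(** If [f] is null, so is [w^m * f], and pairing the latter with [w^j * dual i] reads off the
    coefficient of [f] at [z^i w^j]. The factor [w^m] compensates the shift in [form_dual]. *)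
Lemma form_definite f : span (fun i j => (i < n)%N) f -> B f f = 0 -> f = 0.
Proof.
move=> Sf f0.
have [M SM] : exists M, span (fun i j => (i < n)%N && (j < M)%N) f.
  elim: Sf {f0} => [|i j x f' i_n _ [M SM]]; first by exists 0%N; apply: mspan0.
  exists (maxn j.+1 M); apply: mspan_cons; first by rewrite i_n; lia.
  by apply: span_le SM => a b; lia.
have [a Ef] := span_coef SM.
rewrite Ef big1 // => -[i i_n] _; rewrite big1 // => -[j jM] _ /=.
have dualE := @form_dual _ _ _ _ hB z w Bz Bw n m Pz Rz spanPz adjRz orthoPz approx_invP.
have : B (w ^+ m * f) (w ^+ j * dual z n Pz Rz i) = 0.
  apply: (form_null hB); rewrite -[w ^+ m]mul1r -(expr0 z).
  by rewrite (form_shift Bz Bw).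
rewrite Ef mulr_sumr (form_suml hB) (bigD1 (Ordinal i_n)) //= [X in _ + X]big1 => [|k ki].
  rewrite addr0 mulr_sumr (form_suml hB) (bigD1 (Ordinal jM)) //= [X in _ + X]big1 => [|l lj].
    have -> : w ^+ m * (iota (a i j) * 'e[i, j]) = iota (a i j) * 'e[i, j + m].
      by rewrite exprD; ring.
    by rewrite addr0 (formZl hB) dualE // !eqxx mulr1 => ->; rewrite rmorph0 mul0r.
  have -> : w ^+ m * (iota (a i l) * 'e[i, l]) = iota (a i l) * 'e[i, l + m].
    by rewrite exprD; ring.
  rewrite (formZl hB) dualE // eqn_add2r.
  by move: lj; rewrite -val_eqE /= => /negPf->; rewrite andbF mulr0.
rewrite mulr_sumr (form_suml hB) big1 // => l _.
have -> : w ^+ m * (iota (a k l) * 'e[k, l]) = iota (a k l) * 'e[k, l + m].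
  by rewrite exprD; ring.
rewrite (formZl hB) dualE //.
by move: ki; rewrite -val_eqE /= => /negPf->; rewrite mulr0.
Qed.

Lemma span_projection (N M L : nat) f :
  exists2 g, span (fun i j => (i < N)%N && (L <= j < M)%N) g &
   forall i j, (i < N)%N -> (L <= j < M)%N -> B (f - g) 'e[i, j] = 0.
Proof.
pose s := [seq 'e[i, j] | i <- seq.iota 0 N, j <- seq.iota L (M - L)].
have [||||g [Sg og _]] := @projection_exists _ _ iota _ hB
  (span (fun i j => (i < N)%N && (L <= j < M)%N)) s f.
- by move=> *; apply: spanD.
- by move=> *; apply: spanZ.
- exact: mspan0.
- move=> g /allpairsP[[i j] /= [iN jM ->]]; apply: span_mon.
  by move: iN jM; rewrite !mem_iota; lia.
exists g => // i j iN jM; apply: og; apply/allpairsP; exists (i, j) => /=.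
by rewrite !mem_iota; split=> //; lia.
Qed.

(** * The families [U] and [V] as orthonormal bases of one space *)

Hypotheses (n0 : (0 < n)%N) (m0 : (0 < m)%N).
Variables (d1 d2 : nat) (e1 : 'I_d1 -> A) (e2 : 'I_d2 -> A).
Hypotheses (e1_H1 : forall k, inH1 (e1 k)) (e2_H2 : forall k, inH2 (e2 k)).
Hypotheses (e1_on : orthonormal e1 B) (e2_on : orthonormal e2 B).
Hypothesis e1_gen : forall f, inH1 f -> lincomb iota e1 f.
Hypothesis e2_gen : forall f, inH2 f -> lincomb iota e2 f.

Let T : finType := ('I_1 + ('I_d1 + 'I_d2))%type.
Let U (t : T) := match t with inl _ => p | inr (inl k) => w * e1 k | inr (inr k) => z * e2 k end.
Let V (t : T) := match t with inl _ => q | inr (inl k) => e1 k | inr (inr k) => e2 k end.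
Let inner := span (fun i j => (i < n)%N && (0 < j <= m)%N).
Let outer := span (fun i j => (i <= n)%N && (j <= m)%N).

(** The row [j = m] for [e1 k] is not covered by the definition of H1; it is [H1_orth]. *)
Let V_mon t i j : (i < n)%N -> (0 < j <= m)%N -> B (V t) 'e[i, j] = 0.
Proof.
move=> i_n /andP[j0 jm]; case: t => [o|[k|k]] /=; last 2 first.
- move: jm; rewrite leq_eqVlt => /orP[/eqP->|jm]; first exact: (H1_orth m0).
  by have [_] := e1_H1 k; apply.
- by have [_] := e2_H2 k; apply; rewrite ?j0.
- by apply: (form_eq0C hB); apply: dtilde_orth; rewrite i_n.
Qed.

(** For [z * e2 k] the column [i = 0] is where [H2_orth_shifted] enters. For [w * e1 k], and for
    [z * e2 k] with [i > 0], a variable cancels and the definitions suffice. *)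
Let U_mon t i j : (i < n)%N -> (0 < j <= m)%N -> B (U t) 'e[i, j] = 0.
Proof.
move=> i_n /andP[j0 jm]; case: t => [o|[k|k]] /=; last 2 first.
- have -> : 'e[i, j] = w * 'e[i, j.-1] by rewrite mulrCA -exprS prednK.
  by rewrite Bw; have [_] := e1_H1 k; apply=> //; lia.
- case: i i_n => [|i] i_n; first by rewrite expr0 mul1r; apply: H2_orth_shifted.
  have -> : 'e[i.+1, j] = z * 'e[i, j] by rewrite exprS mulrA.
  by rewrite Bz; have [_] := e2_H2 k; apply; rewrite ?j0 //; lia.
- by apply: (form_eq0C hB); apply: dpoly_orth; rewrite j0 orbT.
Qed.

Let V_on : orthonormal V B.
Proof.
have qe (S : nat -> nat -> bool) f : span S f ->
    (forall i j, S i j -> (i < n)%N || (j < m)%N) -> B q f = 0.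
  move=> Sf H; apply: (form_eq0C hB).
  by apply: (span_orthl hB Sf) => i j Sij; apply: dtilde_orth; apply: H.
(* On the monomials of [e2 l], the row [j = 0] follows from the definition of H1 and the rows
   [j > 0] from [V_mon]. *)
have e12 k l : B (e1 k) (e2 l) = 0.
  have [Sl _] := e2_H2 l.
  apply: (span_orthr hB Sl) => i j /andP[i_n jm].
  case: j jm => [|j] jm; last by apply: (@V_mon (inr (inl k))).
  by have [_] := e1_H1 k; apply.
have q1 k : B q (e1 k) = 0.
  by have [S1 _] := e1_H1 k; apply: (qe _ _ S1) => i j /andP[_ ->]; rewrite orbT.
have q2 k : B q (e2 k) = 0.
  by have [S2 _] := e2_H2 k; apply: (qe _ _ S2) => i j /andP[->].
case=> [o|[k|k]] [o'|[l|l]] /=.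
- by rewrite (ord1 o) (ord1 o') eqxx; exact: dtilde_norm.
- exact: q1.
- exact: q2.
- exact: (form_eq0C hB (q1 k)).
- exact: e1_on.
- exact: e12.
- exact: (form_eq0C hB (q2 k)).
- exact: (form_eq0C hB (e12 l k)).
- exact: e2_on.
Qed.

Let U_on : orthonormal U B.
Proof.
have pe (S : nat -> nat -> bool) f : span S f ->
    (forall i j, S i j -> (0 < i)%N || (0 < j)%N) -> B p f = 0.
  move=> Sf H; apply: (form_eq0C hB).
  by apply: (span_orthl hB Sf) => i j Sij; apply: dpoly_orth; apply: H.
have S1 k : span (fun i j => (i <= n)%N && (0 < j <= m)%N) (w * e1 k).
  have [Sk _] := e1_H1 k; have -> : w * e1 k = 'e[0, 1] * e1 k by rewrite expr1 expr0 mul1r.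
  by apply: span_shift Sk => i j; lia.
have S2 k : span (fun i j => (0 < i)%N) (z * e2 k).
  have [Sk _] := e2_H2 k; have -> : z * e2 k = 'e[1, 0] * e2 k by rewrite expr1 expr0 mulr1.
  by apply: span_shift Sk => i j; lia.
(* On the monomials of [w * e1 l], the column [i = 0] is [H2_orth_shifted]; for [i > 0] a factor [z]
   cancels. *)
have e21 k l : B (z * e2 k) (w * e1 l) = 0.
  apply: (span_orthr hB (S1 l)) => i j /andP[i_n jm].
  case: i i_n => [|i] i_n.
    by rewrite expr0 mul1r; apply: H2_orth_shifted => //; case/andP: jm.
  have -> : 'e[i.+1, j] = z * 'e[i, j] by rewrite exprS mulrA.
  by rewrite Bz; have [_] := e2_H2 k; apply.
have p1 k : B p (w * e1 k) = 0.
  by apply: (pe _ _ (S1 k)) => i j; lia.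
have p2 k : B p (z * e2 k) = 0.
  by apply: (pe _ _ (S2 k)) => i j ->.
case=> [o|[k|k]] [o'|[l|l]] /=.
- by rewrite (ord1 o) (ord1 o') eqxx; exact: dpoly_norm.
- exact: p1.
- exact: p2.
- exact: (form_eq0C hB (p1 k)).
- by rewrite Bw; exact: e1_on.
- exact: (form_eq0C hB (e21 l k)).
- exact: (form_eq0C hB (p2 k)).
- exact: e21.
- by rewrite Bz; exact: e2_on.
Qed.

Let lincomb_inner (Y : T -> A) :=
  fun f => exists g h, [/\ lincomb iota Y g, inner h & f = g + h].

Let liD Y f f' : lincomb_inner Y f -> lincomb_inner Y f' -> lincomb_inner Y (f + f').
Proof.
move=> [g [h [Yg Ih ->]]] [g' [h' [Yg' Ih' ->]]]; exists (g + g'), (h + h').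
by split; [apply: lincombD | apply: spanD | rewrite addrACA].
Qed.

Let liZ Y a f : lincomb_inner Y f -> lincomb_inner Y (iota a * f).
Proof.
move=> [g [h [Yg Ih ->]]]; exists (iota a * g), (iota a * h).
by split; [apply: lincombZ | apply: spanZ | rewrite mulrDr].
Qed.

Let li_inner Y h : inner h -> lincomb_inner Y h.
Proof. by move=> Ih; exists 0, h; split=> //; [apply: lincomb0 | rewrite add0r]. Qed.

Let li_lincomb Y g : lincomb iota Y g -> lincomb_inner Y g.
Proof. by move=> Yg; exists g, 0; split=> //; [apply: mspan0 | rewrite addr0]. Qed.

Let li_span Y S f : span S f -> (forall i j, S i j -> lincomb_inner Y 'e[i, j]) ->
  lincomb_inner Y f.
Proof.
move=> Sf H; elim: Sf => [|i j a f' Sij _ IH].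
  by apply: li_inner; apply: mspan0.
by apply: liD => //; apply: liZ; apply: H.
Qed.

Let H1_decomp f : span (fun i j => (i <= n)%N && (j < m)%N) f ->
  exists2 g, inH1 (f - g) & span (fun i j => (i < n)%N && (j < m)%N) g.
Proof.
move=> Sf; have [g Sg og] := span_projection n m 0 f; exists g => //; split.
  by apply: spanB => //; apply: span_le Sg => i j; lia.
by move=> i j i_n jm; apply: og.
Qed.

Let H2_decomp f : span (fun i j => (i < n)%N && (j <= m)%N) f ->
  exists2 g, inH2 (f - g) & inner g.
Proof.
move=> Sf; have [g Sg og] := span_projection n m.+1 1 f; exists g => //; split.
  by apply: spanB => //; apply: span_le Sg => i j; lia.
by move=> i j i_n jm; apply: og.
Qed.

(** Every monomial but [z^n w^m] lies in the box of H1 or of H2, and the remainder of an H1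
    projection lies in the box of H2. The corner monomial comes from [q], whose coefficient there is
    the conjugate of [c 0 0]. *)
Let outer_V f : outer f -> lincomb_inner V f.
Proof.
have V1 g : inH1 g -> lincomb_inner V g.
  move=> /e1_gen Hg; apply: li_lincomb; rewrite -[g]mul1r; apply: lincomb_trans Hg => k.
  by rewrite mul1r; apply: (lincomb_mem _ V (inr (inl k))).
have V2 g : inH2 g -> lincomb_inner V g.
  move=> /e2_gen Hg; apply: li_lincomb; rewrite -[g]mul1r; apply: lincomb_trans Hg => k.
  by rewrite mul1r; apply: (lincomb_mem _ V (inr (inr k))).
have W2 g : span (fun i j => (i < n)%N && (j <= m)%N) g -> lincomb_inner V g.
  move=> /H2_decomp [h Hh Ih]; rewrite -(subrK h g).
  by apply: liD; [apply: V2 | apply: li_inner].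
have W1 g : span (fun i j => (i <= n)%N && (j < m)%N) g -> lincomb_inner V g.
  move=> /H1_decomp [h Hh Ih]; rewrite -(subrK h g).
  by apply: liD; [apply: V1 | apply: W2; apply: span_le Ih => i j; lia].
have mon i j : (i <= n)%N -> (j <= m)%N -> ~~ ((i == n) && (j == m)) ->
    lincomb_inner V 'e[i, j].
  move=> i_n jm ij; have [jm'|mj] := ltnP j m.
    by apply: W1; apply: span_mon; rewrite i_n.
  by apply: W2; apply: span_mon; lia.
move=> Sf; apply: (li_span Sf) => i j /andP[i_n jm].
have [/andP[/eqP-> /eqP->]|] := boolP ((i == n) && (j == m)); last exact: mon.
have [r Er Sr] : exists2 r, q = iota (c 0 0)^* * 'e[n, m] + r &
    span (fun i j => [&& (i <= n)%N, (j <= m)%N & ~~ ((i == n) && (j == m))]) r.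
  rewrite /dtilde big_ord_recl big_ord_recl /= !subn0 -addrA; eexists; first by [].
  apply: spanD; apply: span_sum => k _; last first.
    apply: span_sum => l _; apply: spanZ; apply: span_mon.
    by rewrite /bump leq0n; have := ltn_ord k; lia.
  apply: spanZ; apply: span_mon; rewrite /bump leq0n; have := ltn_ord k; lia.
have -> : 'e[n, m] = iota (c 0 0)^*^-1 * (q - r).
  rewrite Er addrK mulrA -rmorphM mulVf ?rmorph1 ?mul1r //.
  by rewrite conjC_eq0.
apply: liZ; apply: liD.
  by apply: li_lincomb; apply: (lincomb_mem _ V (inl ord0)).
rewrite -mulN1r -(rmorphN1 iota); apply: liZ; apply: (li_span Sr) => a b /and3P[*].
exact: mon.
Qed.

(** A monomial with [j > 0] is [w] times one in the box of H1, and [w] moves the remainder into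
    [inner]. A positive power of [z] is [z] times one in the box of H2, with a remainder of the
    previous kind. The constant comes from [p], as [c 0 0] is nonzero. *)
Let outer_U f : outer f -> lincomb_inner U f.
Proof.
have S1 i j : (i <= n)%N -> (0 < j <= m)%N -> lincomb_inner U 'e[i, j].
  move=> i_n /andP[j0 jm].
  have -> : 'e[i, j] = w * 'e[i, j.-1] by rewrite mulrCA -exprS prednK.
  have [|h Hh Sh] := @H1_decomp 'e[i, j.-1].
    by apply: span_mon; lia.
  rewrite -(subrK h 'e[i, _]) mulrDr; apply: liD.
    apply: li_lincomb; apply: lincomb_trans (e1_gen Hh) => k.
    exact: (lincomb_mem _ U (inr (inl k))).
  apply: li_inner; have -> : w * h = 'e[0, 1] * h by rewrite expr1 expr0 mul1r.
  by apply: span_shift Sh => a b; lia.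
have S2 i j : (i <= n)%N -> (j <= m)%N -> (0 < i)%N || (0 < j)%N -> lincomb_inner U 'e[i, j].
  move=> i_n jm; case: j jm => [|j] jm; last by move=> _; apply: S1.
  case: i i_n => [|i] i_n // _.
  have -> : 'e[i.+1, 0] = z * 'e[i, 0] by rewrite exprS mulrA.
  have [|h Hh Sh] := @H2_decomp 'e[i, 0].
    by apply: span_mon; lia.
  rewrite -(subrK h 'e[i, _]) mulrDr; apply: liD.
    apply: li_lincomb; apply: lincomb_trans (e2_gen Hh) => k.
    exact: (lincomb_mem _ U (inr (inr k))).
  have Szh : span (fun i j => (i <= n)%N && (0 < j <= m)%N) (z * h).
    have -> : z * h = 'e[1, 0] * h by rewrite expr1 expr0 mulr1.
    by apply: span_shift Sh => a b; lia.
  by apply: (li_span Szh) => a b /andP[]; apply: S1.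
move=> Sf; apply: (li_span Sf) => i j /andP[i_n jm].
case: i i_n => [|i] i_n; last exact: S2.
case: j jm => [|j] jm; last exact: S2.
have [r Er Sr] : exists2 r, p = iota (c 0 0) * 'e[0, 0] + r &
    span (fun i j => [&& (i <= n)%N, (j <= m)%N & (0 < i)%N || (0 < j)%N]) r.
  rewrite /dpoly big_ord_recl big_ord_recl /= -addrA; eexists; first by [].
  apply: spanD; apply: span_sum => k _; last first.
    apply: span_sum => l _; apply: spanZ; apply: span_mon.
    by rewrite /bump leq0n; have := ltn_ord k; have := ltn_ord l; lia.
  apply: spanZ; apply: span_mon; rewrite /bump leq0n; have := ltn_ord k; lia.
have -> : 'e[0, 0] = iota (c 0 0)^-1 * (p - r).
  by rewrite Er addrK mulrA -rmorphM mulVf ?rmorph1 ?mul1r.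
apply: liZ; apply: liD.
  by apply: li_lincomb; apply: (lincomb_mem _ U (inl ord0)).
rewrite -mulN1r -(rmorphN1 iota); apply: liZ; apply: (li_span Sr) => a b /and3P[*].
exact: S2.
Qed.

(** In [f = g + h] the part [h] lies in [inner] and is orthogonal to [inner], hence it is null and
    vanishes by [form_definite]. *)
Let generates Y f : (forall t i j, (i < n)%N -> (0 < j <= m)%N -> B (Y t) 'e[i, j] = 0) ->
  (forall i j, (i < n)%N -> (0 < j <= m)%N -> B f 'e[i, j] = 0) ->
  lincomb_inner Y f -> lincomb iota Y f.
Proof.
move=> Y0 f0 [g [h [Yg Ih Ef]]].
have inner_orth k : (forall i j, (i < n)%N -> (0 < j <= m)%N -> B k 'e[i, j] = 0) -> B k h = 0.
  by move=> k0; apply: (span_orthr hB Ih) => i j /andP[]; apply: k0.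
have gh : B g h = 0.
  case: Yg => a ->; rewrite (form_suml hB) big1 // => t _.
  by rewrite (formZl hB) inner_orth ?mulr0 //; apply: Y0.
have h0 : h = 0.
  apply: form_definite; first by apply: span_le Ih => i j /andP[].
  by have := inner_orth _ f0; rewrite Ef (formDl hB) gh add0r.
by rewrite Ef h0 addr0.
Qed.

Lemma kernel_decomposition (phi psi : {rmorphism A -> C}) :
  cancel iota phi -> cancel iota psi ->
  phi p * (psi p)^* - phi q * (psi q)^* =
    (1 - phi w * (psi w)^*) * (\sum_k phi (e1 k) * (psi (e1 k))^*) +
    (1 - phi z * (psi z)^*) * (\sum_k phi (e2 k) * (psi (e2 k))^*).
Proof.
move=> phiK psiK.
have outer_V_mem t : outer (V t).
  case: t => [o|[k|k]] /=; last 2 first.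
  - by have [Sk _] := e1_H1 k; apply: span_le Sk => i j; lia.
  - by have [Sk _] := e2_H2 k; apply: span_le Sk => i j; lia.
  apply: span_sum => i _; apply: span_sum => j _; apply: spanZ; apply: span_mon; lia.
have outer_U_mem t : outer (U t).
  case: t => [o|[k|k]] /=; last 2 first.
  - have [Sk _] := e1_H1 k; have -> : w * e1 k = 'e[0, 1] * e1 k by rewrite expr1 expr0 mul1r.
    by apply: span_shift Sk => i j; lia.
  - have [Sk _] := e2_H2 k; have -> : z * e2 k = 'e[1, 0] * e2 k by rewrite expr1 expr0 mulr1.
    by apply: span_shift Sk => i j; lia.
  apply: span_sum => i _; apply: span_sum => j _; apply: spanZ; apply: span_mon.
  by have := ltn_ord i; have := ltn_ord j; lia.
have VU t : lincomb iota U (V t).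
  by apply: (generates U_mon (V_mon t)); apply: outer_U.
have UV t : lincomb iota V (U t).
  by apply: (generates V_mon (U_mon t)); apply: outer_V.
have := eq_kernel hB phiK psiK U_on V_on VU UV.
rewrite !big_sumType !big_ord1 /=.
under eq_bigr => k _ do rewrite !rmorphM mulrACA.
rewrite -mulr_sumr.
under [X in _ + (_ + X)]eq_bigr => k _ do rewrite !rmorphM mulrACA.
rewrite -mulr_sumr /= => E.
set s1 := \sum_k phi (e1 k) * _ in E *.
set s2 := \sum_k phi (e2 k) * _ in E *.
apply/eqP; rewrite -subr_eq0; move/eqP: E; rewrite -subr_eq0 => /eqP E.
by rewrite -[0]E; apply/eqP; ring.
Qed.

End Bidisk.

(** * Polynomial approximation of 1/p on the closed bidisk *)

Section Evaluation.

Variable C : numClosedFieldType.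
Local Notation A := {poly {poly C}}.

Definition const2 : {rmorphism C -> A} := polyC \o polyC.
(** The outer variable ['X] stands for [z] and the constant polynomial ['X%:P] for [w]; hence [x] is
    substituted first. *)
Definition eval2 (x y : C) : {rmorphism A -> C} := horner_eval y \o horner_eval x%:P.
Local Notation Z := ('X : A).
Local Notation W := ('X%:P : A).

Lemma eval2_const x y : cancel const2 (eval2 x y).
Proof. by move=> a; rewrite /= /horner_eval !hornerC. Qed.

Lemma eval2Z x y : eval2 x y Z = x.
Proof. by rewrite /= /horner_eval hornerX hornerC. Qed.

Lemma eval2W x y : eval2 x y W = y.
Proof. by rewrite /= /horner_eval hornerC hornerX. Qed.

Lemma eval2_mon x y i j : eval2 x y (Z ^+ i * W ^+ j) = x ^+ i * y ^+ j.
Proof. by rewrite rmorphM !rmorphXn eval2Z eval2W. Qed.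

Lemma eval2_dpoly n m c x y : eval2 x y (dpoly const2 Z W n m c) =
  \sum_(i < n.+1) \sum_(j < m.+1) c i j * (x ^+ i * y ^+ j).
Proof.
rewrite rmorph_sum; apply: eq_bigr => i _; rewrite rmorph_sum; apply: eq_bigr => j _.
by rewrite rmorphM eval2_const eval2_mon.
Qed.

Lemma eval2_dtilde n m c x y : eval2 x y (dtilde const2 Z W n m c) =
  \sum_(i < n.+1) \sum_(j < m.+1) (c i j)^* * (x ^+ (n - i) * y ^+ (m - j)).
Proof.
rewrite rmorph_sum; apply: eq_bigr => i _; rewrite rmorph_sum; apply: eq_bigr => j _.
by rewrite rmorphM eval2_const eval2_mon.
Qed.

Lemma poly_horner_inj (D : idomainType) (s : nat -> D) (f : {poly D}) :
  injective s -> (forall k, f.[s k] = 0) -> f = 0.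
Proof.
move=> s_inj f0; apply/eqP; apply: contraT => fn0.
have := @max_poly_roots _ f [seq s k | k <- seq.iota 0 (size f)] fn0.
rewrite size_map size_iota ltnn map_inj_uniq // iota_uniq => -> //.
by apply/allP => x /mapP[k _ ->]; apply/eqP; apply: f0.
Qed.

(** A difference vanishing at all pairs of natural numbers is zero, by counting roots once in each
    variable. *)
Lemma eval2_inj (f g : A) : (forall x y, eval2 x y f = eval2 x y g) -> f = g.
Proof.
move=> fg; apply/eqP; rewrite -subr_eq0; apply/eqP.
have natC : injective (fun k : nat => k%:R : C).
  by move=> k l /eqP; rewrite eqr_nat => /eqP.
apply: (@poly_horner_inj _ (fun k : nat => (k%:R : C)%:P)) => [k l /polyC_inj/natC //|k].
apply: (poly_horner_inj natC) => l.
have := fg k%:R l%:R; rewrite /= /horner_eval => E.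
by rewrite hornerD hornerN hornerD hornerN E subrr.
Qed.

Lemma span_all (f : A) : exists d, mspan const2 Z W (fun i j => (i <= d)%N && (j <= d)%N) f.
Proof.
exists ((\max_(i < size f) size (f`_i)%R)%N + size f)%N.
rewrite -[X in mspan _ _ _ _ X]coefK poly_def; apply: span_sum => i _.
rewrite -[f`_i]coefK poly_def scaler_suml; apply: span_sum => j _.
have -> : (f`_i)`_j *: 'X^j *: 'X^i = const2 (f`_i)`_j * (Z ^+ i * W ^+ j).
  by rewrite /= -mul_polyC -mul_polyC polyCM polyC_exp; ring.
apply: spanZ; apply: span_mon.
apply/andP; split; first exact: leq_trans (ltnW (ltn_ord i)) (leq_addl _ _).
apply: leq_trans (ltnW (ltn_ord j)) (leq_trans _ (leq_addr _ _)).
exact: (@leq_bigmax _ (fun i : 'I_(size f) => size f`_i) i).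
Qed.

End Evaluation.

Section Approximation.

Local Notation C := R[i].
Local Notation A := {poly {poly C}}.
Local Notation Z := ('X : A).
Local Notation W := ('X%:P : A).

Lemma nat_upper_bound (x : C) : 0 <= x -> exists N : nat, x < N%:R.
Proof.
case: x => a b; rewrite lecE /= => /andP[/eqP -> a0].
exists (Num.bound a); rewrite -(rmorph_nat (real_complex R)) ltcE /= eqxx.
exact: archi_boundP.
Qed.

Variables (n m : nat) (c : nat -> nat -> C) (d : C).
Hypothesis d0 : 0 < d.
Let value x y := \sum_(i < n.+1) \sum_(j < m.+1) c i j * (x ^+ i * y ^+ j).
Hypothesis lower : forall x y, `|x| <= 1 -> `|y| <= 1 -> d <= `|value x y|.
Let dilation (t : C) := dpoly (const2 _) Z W n m (fun i j => c i j * t ^+ (i + j)).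

Lemma eval2_dilation t x y : eval2 x y (dilation t) = value (t * x) (t * y).
Proof.
rewrite eval2_dpoly; apply: eq_bigr => i _; apply: eq_bigr => j _.
by rewrite !exprMn exprD; ring.
Qed.

(** A truncated Neumann series: the error of an approximate inverse can be raised to any power. *)
Lemma geometric_inverse (p r : A) (k : nat) : exists r' : A, 1 - p * r' = (1 - p * r) ^+ k.
Proof.
exists (r * \sum_(i < k) (1 - p * r) ^+ i).
rewrite mulrA; have := subrX1 (1 - p * r) k.
rewrite (_ : 1 - p * r - 1 = - (p * r)); last by ring.
by rewrite mulNr => /eqP; rewrite subr_eq => /eqP ->; rewrite addrC.
Qed.

(** Continuation from the dilation by [t] to the one by [s]. From [d * |r| <= |p_t r| <= 4/3] and a
    change of [p] by at most [d / 4], the same [r] has error at most [1/3 + 1/3] at [s]; the third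
    power [8/27] of this error is again below [1/3]. *)
Lemma approx_step (s t : C) (r : A) :
  (forall x y, `|x| <= 1 -> `|y| <= 1 -> `|1 - eval2 x y (dilation t * r)| <= 3^-1) ->
  0 <= t <= 1 ->
  (forall x y, `|x| <= 1 -> `|y| <= 1 ->
     `|value (t * x) (t * y) - value (s * x) (s * y)| <= d / 4) ->
  exists r' : A, forall x y, `|x| <= 1 -> `|y| <= 1 ->
    `|1 - eval2 x y (dilation s * r')| <= 3^-1.
Proof.
move=> Hr /andP[t0 t1] Hst.
have [r' Er'] := geometric_inverse (dilation s) r 3.
exists r' => x y x1 y1.
rewrite -(rmorph1 (eval2 x y)) -rmorphB Er' rmorphXn normrX.
apply: (@le_trans _ _ ((2 / 3) ^+ 3)); last first.
  rewrite -subr_ge0 (_ : _ - _ = 27^-1); first by rewrite invr_ge0 ler0n.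
  by field.
apply: lerXn2r; [by rewrite nnegrE | by rewrite nnegrE divr_ge0 ?ler0n |].
set a := eval2 x y (dilation t * r); have a8 : `|1 - a| <= 3^-1 by apply: Hr.
set pt := value (t * x) (t * y); set ps := value (s * x) (s * y).
have dpt : d <= `|pt|.
  apply: lower; rewrite normrM (ger0_norm t0).
    by rewrite -[1]mulr1 ler_pM.
  by rewrite -[1]mulr1 ler_pM.
have a98 : `|a| <= 4 / 3.
  have := ler_normD (a - 1) 1; rewrite subrK normr1 distrC => /le_trans; apply.
  rewrite (_ : 4 / 3 = 3^-1 + 1) ?lerD2r //; by field.
have ar : pt * eval2 x y r = a by rewrite /a rmorphM eval2_dilation.
have E : eval2 x y (1 - dilation s * r) = (1 - a) + (pt - ps) * eval2 x y r.
  by rewrite rmorphB rmorph1 rmorphM eval2_dilation -ar -/ps; ring.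
rewrite E.
apply: (le_trans (ler_normD _ _)).
have -> : 2 / 3 = 3^-1 + 3^-1 :> C by field.
apply: lerD => //; rewrite normrM.
have r_le : d * `|eval2 x y r| <= 4 / 3.
  apply: le_trans a98; rewrite -ar normrM; exact: ler_wpM2r.
apply: (@le_trans _ _ (d / 4 * `|eval2 x y r|)).
  by apply: ler_wpM2r => //; apply: Hst.
rewrite mulrAC ler_pdivrMr // (le_trans r_le) //.
by rewrite (_ : 3^-1 * 4 = 4 / 3 :> C) //; by field.
Qed.

Let L := \sum_(i < n.+1) \sum_(j < m.+1) `|c i j| * (i + j)%:R.

(** In the factorization of [t^k - s^k] by [t - s] the cofactor has [k] summands of modulus at most
    one; this explains the weights [i + j] in [L]. *)
Lemma value_lipschitz (s t x y : C) : 0 <= s <= 1 -> 0 <= t <= 1 ->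
  `|x| <= 1 -> `|y| <= 1 ->
  `|value (t * x) (t * y) - value (s * x) (s * y)| <= L * `|t - s|.
Proof.
move=> /andP[s0 s1] /andP[t0 t1] x1 y1.
rewrite -sumrB mulr_suml; apply: (le_trans (ler_norm_sum _ _ _)); apply: ler_sum => i _.
rewrite -sumrB mulr_suml; apply: (le_trans (ler_norm_sum _ _ _)); apply: ler_sum => j _.
have -> : c i j * ((t * x) ^+ i * (t * y) ^+ j) - c i j * ((s * x) ^+ i * (s * y) ^+ j) =
    c i j * ((t ^+ (i + j) - s ^+ (i + j)) * (x ^+ i * y ^+ j)).
  by rewrite !exprMn !exprD; ring.
rewrite normrM -mulrA; apply: ler_wpM2l => //.
rewrite normrM -[X in _ <= X]mulr1; apply: ler_pM => //.
  rewrite subrXX normrM mulrC; apply: ler_wpM2r => //.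
  apply: (le_trans (ler_norm_sum _ _ _)).
  rewrite -[X in _ <= X%:R]card_ord -sumr_const; apply: ler_sum => k _.
  rewrite normrM !normrX (ger0_norm s0) (ger0_norm t0) -[1]mulr1.
  by apply: ler_pM; rewrite ?exprn_ge0 ?exprn_ile1.
by rewrite normrM !normrX -[1]mulr1 ler_pM ?exprn_ge0 ?exprn_ile1.
Qed.

Lemma approx_inverse_third : exists r : A, forall x y, `|x| <= 1 -> `|y| <= 1 ->
  `|1 - eval2 x y (dilation 1 * r)| <= 3^-1.
Proof.
have L0 : 0 <= L by apply: sumr_ge0 => i _; apply: sumr_ge0 => j _; rewrite mulr_ge0 ?ler0n.
have Ld0 : 0 <= L * 4 / d by rewrite divr_ge0 ?mulr_ge0 ?(ltW d0) ?ler0n.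
(* Since [N > 4 L / d], each of the [N] steps from the constant [p(0, 0)] to [p] changes the values
   by at most [d / 4]. *)
have [N NL] := nat_upper_bound Ld0.
have N0 : 0 < (N%:R : C) by apply: le_lt_trans NL.
have step k : (k <= N)%N -> exists r : A, forall x y, `|x| <= 1 -> `|y| <= 1 ->
    `|1 - eval2 x y (dilation (k%:R / N%:R) * r)| <= 3^-1.
  elim: k => [_|k IH kN].
    exists (const2 _ (value 0 0)^-1) => x y _ _.
    rewrite rmorphM eval2_dilation !mul0r eval2_const divff ?subrr ?normr0 ?invr_ge0 ?ler0n //.
    by rewrite -normr_gt0 (lt_le_trans d0) // lower ?normr0.
  have [r Hr] := IH (ltnW kN).
  have unit_le l : (l <= N)%N -> 0 <= l%:R / N%:R <= (1 : C).
    by move=> lN; rewrite divr_ge0 ?ler0n //= ler_pdivrMr // mul1r ler_nat.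
  apply: (@approx_step (k.+1%:R / N%:R) (k%:R / N%:R) r Hr) => [|x y x1 y1]; first exact: unit_le (ltnW kN).
  apply: le_trans (@value_lipschitz (k.+1%:R / N%:R) (k%:R / N%:R) x y _ _ x1 y1) _.
  - exact: unit_le.
  - exact: unit_le (ltnW kN).
  rewrite -mulrBl -opprB -natrB // subSnn mulNr normrN ger0_norm ?divr_ge0 ?ler0n //.
  rewrite mul1r ler_pdivrMr // mulrAC ler_pdivlMr ?ltr0n //.
  by rewrite [d * _]mulrC -ler_pdivrMr // ltW.
have [r Hr] := step N (leqnn N); exists r => x y x1 y1.
by have := Hr x y x1 y1; rewrite divff // gt_eqF.
Qed.

Lemma approx_inverse (e : C) : 0 < e -> exists r : A, forall x y, `|x| <= 1 -> `|y| <= 1 ->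
  `|1 - eval2 x y (dpoly (const2 _) Z W n m c * r)| <= e.
Proof.
move=> e0; have [r Hr] := approx_inverse_third.
(* The power [N > 1 / e] suffices because [3^-N <= 2^-N <= 1 / N]. *)
have [|N Ne] := @nat_upper_bound e^-1; first by rewrite invr_ge0 ltW.
have [r' Er'] := geometric_inverse (dilation 1) r N.
exists r' => x y x1 y1.
have <- : dilation 1 = dpoly (const2 _) Z W n m c.
  by apply: eq_bigr => i _; apply: eq_bigr => j _; rewrite expr1n mulr1.
have -> : 1 - eval2 x y (dilation 1 * r') = eval2 x y (1 - dilation 1 * r').
  by rewrite rmorphB rmorph1.
rewrite Er' rmorphXn normrX rmorphB rmorph1.
apply: (@le_trans _ _ (2^-1 ^+ N)).
  apply: lerXn2r; [by rewrite nnegrE | by rewrite nnegrE invr_ge0 ler0n |].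
  by apply: (le_trans (Hr x y x1 y1)); rewrite lef_pV2 ?posrE ?ltr0n // ler_nat.
rewrite exprVn -[e]invrK lef_pV2 ?posrE ?exprn_gt0 ?invr_gt0 ?ltr0n //.
apply: (le_trans (ltW Ne)); rewrite -natrX ler_nat.
by apply: ltnW; apply: ltn_expl.
Qed.

End Approximation.

(** * Transfer to the integral inner product *)

Local Notation C := R[i].
Local Notation A := {poly {poly C}}.
Local Notation Z := ('X : A).
Local Notation W := ('X%:P : A).

Definition toC (a : Cx) : C := Complex (fst a) (snd a).
Definition ofC (x : C) : Cx := (complex.Re x, complex.Im x).

Lemma toCK : cancel toC ofC. Proof. by case. Qed.
Lemma ofCK : cancel ofC toC. Proof. by case. Qed.
Lemma toC_inj : injective toC. Proof. exact: can_inj toCK. Qed.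

Lemma toC0 : toC Czero = 0. Proof. by []. Qed.
Lemma toC1 : toC Cone = 1. Proof. by []. Qed.
Lemma toCD a b : toC (Cadd a b) = toC a + toC b. Proof. by []. Qed.
Lemma toCB a b : toC (Csub a b) = toC a - toC b. Proof. by []. Qed.
Lemma toCM a b : toC (Cmul a b) = toC a * toC b. Proof. by []. Qed.
Lemma toC_conj a : toC (Cconj a) = (toC a)^*. Proof. by []. Qed.

Lemma toCX a k : toC (Cpow a k) = toC a ^+ k.
Proof. by elim: k => [|k IH]; rewrite ?expr0 // exprS -IH. Qed.

Lemma toC_csum a len f : toC (csum a len f) = \sum_(i < len) toC (f (a + i)%N).
Proof. by elim: len => [|k IH]; rewrite ?big_ord0 // big_ord_recr /= -IH. Qed.

Lemma toC_norm a : `|toC a| ^+ 2 = toC (RtoC (Cnorm2 a)).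
Proof.
rewrite normCK -toC_conj -toCM; congr toC.
rewrite /Cmul /Cconj /Cnorm2 /RtoC /=; congr (_, _).
  by rewrite Ropp_mult_distr_r_reverse /Rminus Ropp_involutive.
by rewrite Ropp_mult_distr_r_reverse Rmult_comm Rplus_opp_l.
Qed.

Lemma toC_le (a b : R) : Rle a b -> toC (RtoC a) <= toC (RtoC b).
Proof. by move=> /RleP ab; rewrite lecE /= eqxx. Qed.

Lemma toC_peval c n m z w : toC (peval c n m z w) =
  eval2 (toC z) (toC w) (dpoly (const2 _) Z W n m (fun i j => toC (c i j))).
Proof.
rewrite eval2_dpoly toC_csum; apply: eq_bigr => i _.
by rewrite toC_csum; apply: eq_bigr => j _; rewrite !toCM !toCX.
Qed.

Lemma toC_ptilde c n m z w : toC (ptilde c n m z w) =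
  eval2 (toC z) (toC w) (dtilde (const2 _) Z W n m (fun i j => toC (c i j))).
Proof.
rewrite eval2_dtilde toC_csum; apply: eq_bigr => i _.
by rewrite toC_csum; apply: eq_bigr => j _; rewrite !toCM !toCX.
Qed.

Definition fn_of (f : A) : fn2 := fun z w => ofC (eval2 (toC z) (toC w) f).

Lemma toC_fn_of f z w : toC (fn_of f z w) = eval2 (toC z) (toC w) f.
Proof. exact: ofCK. Qed.

Lemma fn_of_inj : injective fn_of.
Proof.
move=> f g fg; apply: eval2_inj => x y.
by rewrite -(ofCK x) -(ofCK y) -!toC_fn_of fg.
Qed.

Lemma fn2_eq (f g : fn2) : (forall z w, toC (f z w) = toC (g z w)) -> f = g.
Proof.
move=> fg; apply: functional_extensionality => z; apply: functional_extensionality => w.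
exact: toC_inj.
Qed.

Lemma fn_ofD f g : fn_of (f + g) = fun z w => Cadd (fn_of f z w) (fn_of g z w).
Proof. by apply: fn2_eq => z w; rewrite toCD !toC_fn_of rmorphD. Qed.

Lemma fn_ofM f g : fn_of (f * g) = fun z w => Cmul (fn_of f z w) (fn_of g z w).
Proof. by apply: fn2_eq => z w; rewrite toCM !toC_fn_of rmorphM. Qed.

Lemma fn_of_const a : fn_of (const2 _ a) = fun _ _ => ofC a.
Proof. by apply: fn2_eq => z w; rewrite toC_fn_of eval2_const ofCK. Qed.

Lemma fn_of_mon k l : fn_of (Z ^+ k * W ^+ l) = Cmon k l.
Proof. by apply: fn2_eq => z w; rewrite toC_fn_of eval2_mon toCM !toCX. Qed.

Lemma fn_ofZ : fn_of Z = fun z _ => z.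
Proof. by apply: fn2_eq => z w; rewrite toC_fn_of eval2Z. Qed.

Lemma fn_ofW : fn_of W = fun _ w => w.
Proof. by apply: fn2_eq => z w; rewrite toC_fn_of eval2W. Qed.

Lemma fn_of_continuous f : torus_continuous (fn_of f).
Proof.
have [d] := span_all f; elim=> [|i j a g _ _ IH].
  have -> : fn_of 0 = fun _ _ => Czero by apply: fn2_eq => z w; rewrite toC_fn_of rmorph0.
  exact: Ccontinuous_const.
rewrite fn_ofD fn_ofM fn_of_const fn_of_mon.
apply: (Ccontinuous_add _ _ _ _ IH).
apply: (Ccontinuous_mul _ (fun=> ofC a)); first exact: Ccontinuous_const.
apply: Ccontinuous_mon; [exact: Ccontinuous_expi_fst | exact: Ccontinuous_expi_snd].
Qed.

(** * The Hermitian form attached to a stable polynomial *)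

Section StableWeight.

Variables (n m : nat) (c : nat -> nat -> Cx).
Hypothesis c_stable : stable (peval c n m).
Let cC i j := toC (c i j).
Let p : A := dpoly (const2 _) Z W n m cC.

Lemma fn_of_p : fn_of p = peval c n m.
Proof. by apply: fn2_eq => z w; rewrite toC_fn_of toC_peval. Qed.

Definition form (f g : A) : C := toC (ip (peval c n m) (fn_of f) (fn_of g)).
Local Notation B := form.

Let p_cont : torus_continuous (peval c n m).
Proof. by rewrite -fn_of_p; apply: fn_of_continuous. Qed.

Lemma form_hermitian : hermitian_form (const2 _) B.
Proof.
split.
- by move=> f g h; rewrite /form fn_ofD ip_addl //; apply: fn_of_continuous.
- move=> a f g; rewrite /form fn_ofM fn_of_const ip_mull //; try exact: fn_of_continuous.
  by rewrite toCM ofCK.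
- by move=> f g; rewrite /form ip_conj //; apply: fn_of_continuous.
- move=> f; rewrite lecE; apply/andP; split.
    by apply/eqP; apply: ip_self_real => //; apply: fn_of_continuous.
  by apply/RleP; apply: ip_self_ge0 => //; apply: fn_of_continuous.
Qed.

Lemma form_z f g : B (Z * f) (Z * g) = B f g.
Proof.
rewrite /form !fn_ofM fn_ofZ; congr toC.
by apply: (ip_shift _ _ _ (fun z _ => z)) => t1 t2; apply: Cnorm2_expi.
Qed.

Lemma form_w f g : B (W * f) (W * g) = B f g.
Proof.
rewrite /form !fn_ofM fn_ofW; congr toC.
by apply: (ip_shift _ _ _ (fun _ w => w)) => t1 t2; apply: Cnorm2_expi.
Qed.

Lemma form_p_mon k l a b : B (p * (Z ^+ k * W ^+ l)) (p * (Z ^+ a * W ^+ b)) =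
  ((k == a) && (l == b))%:R.
Proof.
rewrite /form (fn_ofM p) (fn_ofM p) !fn_of_mon fn_of_p ip_multiple_mon //.
have E (i j : nat) : Nat.eqb i j = (i == j) by apply/PeanoNat.Nat.eqb_spec/eqP.
by rewrite !E; case: (_ && _).
Qed.

Lemma norm_le1 x : `|x| <= 1 -> Rle (Cnorm2 (ofC x)) (IZR 1).
Proof.
move=> x1; have : `|x| ^+ 2 <= 1 by apply: exprn_ile1.
rewrite -{1}(ofCK x) toC_norm lecE /= => /andP[_ /RleP]; exact.
Qed.

Lemma le_norm1 a : Cnorm2 a = IZR 1 -> `|toC a| <= 1.
Proof.
move=> a1; rewrite -(@ler_pXn2r _ 2) ?nnegrE // toC_norm a1 expr1n.
by rewrite lecE /= eqxx lexx.
Qed.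

(** [stable_lower_bound] bounds [|p|^2] from below. The square root of that bound serves for [|p|],
    and its inverse [K] turns uniform bounds into norm bounds. *)
Lemma exists_bound : exists d K : C, [/\ 0 < d,
  forall x y, `|x| <= 1 -> `|y| <= 1 -> d <= `|eval2 x y p|, 0 < K &
  forall (f : A) (e : C), 0 <= e ->
    (forall x y, `|x| <= 1 -> `|y| <= 1 -> `|eval2 x y f| <= e) -> fnorm B f <= K * e].
Proof.
have [d [d0 Hd]] := stable_lower_bound c n m c_stable.
have dC0 : 0 < toC (RtoC d) by rewrite ltcE /= eqxx; apply/RltP.
exists (sqrtC (toC (RtoC d))), (sqrtC (toC (RtoC d)))^-1.
rewrite invr_gt0 !sqrtC_gt0; split=> // [x y x1 y1|f e e0 He].
  rewrite -(@ler_pXn2r _ 2) ?nnegrE ?sqrtC_ge0 ?(ltW dC0) // sqrtCK.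
  rewrite -{1}(ofCK x) -{1}(ofCK y) -toC_peval toC_norm.
  by apply: toC_le; apply: Hd; apply: norm_le1.
rewrite -(@ler_pXn2r _ 2) ?nnegrE ?mulr_ge0 ?invr_ge0 ?sqrtC_ge0 ?(ltW dC0) //; last first.
  exact: (form_ge0 form_hermitian).
rewrite exprMn exprVn sqrtCK /fnorm sqrtCK.
have [M EM] : exists M : R, e ^+ 2 = toC (RtoC M).
  have : 0 <= e ^+ 2 by rewrite exprn_ge0.
  by case: (e ^+ 2) => a b; rewrite lecE /= => /andP[/eqP-> _]; exists a.
have invE : (toC (RtoC d))^-1 = toC (RtoC (Rinv d)).
  have dn0 : toC (RtoC d) != 0 by rewrite gt_eqF.
  apply: (mulfI dn0); rewrite divff //.
  rewrite -toCM -toC1; congr toC; rewrite /Cmul /RtoC /Cone /=.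
  rewrite Rinv_r; last exact: Rgt_not_eq.
  by rewrite !Rmult_0_l Rmult_0_r Rminus_0_r Rplus_0_l.
rewrite invE EM -toCM.
have real : snd (ip (peval c n m) (fn_of f) (fn_of f)) = IZR 0.
  by apply: ip_self_real => //; apply: fn_of_continuous.
have E : toC (Cmul (RtoC (Rinv d)) (RtoC M)) = toC (RtoC (Rmult (Rinv d) M)).
  congr toC; rewrite /Cmul /RtoC; congr (_, _).
    by rewrite Rmult_0_l Rminus_0_r.
  by rewrite Rmult_0_l Rmult_0_r Rplus_0_l.
rewrite E lecE; apply/andP; split.
  by apply/eqP; symmetry; apply: real.
apply/RleP; apply: ip_self_le => // [|t1 t2|t1 t2].
- exact: fn_of_continuous.
- by apply: Hd; rewrite Cnorm2_expi; apply: Rle_refl.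
have : `|toC (fn_of f (Cexpi t1) (Cexpi t2))| ^+ 2 <= e ^+ 2.
  rewrite ler_pXn2r ?nnegrE // toC_fn_of.
  by apply: He; apply: le_norm1; apply: Cnorm2_expi.
by rewrite toC_norm EM lecE /= => /andP[_ /RleP].
Qed.

End StableWeight.

Local Notation span := (mspan (const2 _) Z W).

Lemma eval2_upolyW m d x y : eval2 x y (upoly (const2 C) W m d) = \sum_(j < m.+1) d j * y ^+ j.
Proof.
by rewrite rmorph_sum; apply: eq_bigr => j _; rewrite rmorphM eval2_const rmorphXn eval2W.
Qed.

Lemma eval2_upolyZ n d x y : eval2 x y (upoly (const2 C) Z n d) = \sum_(i < n.+1) d i * x ^+ i.
Proof.
by rewrite rmorph_sum; apply: eq_bigr => j _; rewrite rmorphM eval2_const rmorphXn eval2Z.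
Qed.

(** Setting [z = 0] in an approximate inverse of [p] gives one of [p(0, w)] that involves [w]
    alone. *)
Lemma restrict_w (r : A) : exists2 s : A, span (fun i j => (i == 0)%N) s &
  forall x y, eval2 x y s = eval2 0 y r.
Proof.
pose t := r.[0%:P].
exists (\sum_(j < size t) const2 _ t`_j * (Z ^+ 0 * W ^+ j)) => [|x y].
  by apply: span_sum => j _; apply: spanZ; apply: span_mon.
have -> : eval2 0 y r = \sum_(j < size t) t`_j * y ^+ j.
  by rewrite /= /horner_eval (horner_coef t).
rewrite rmorph_sum; apply: eq_bigr => j _.
by rewrite rmorphM eval2_const eval2_mon mul1r.
Qed.

Lemma restrict_z (r : A) : exists2 s : A, span (fun i j => (j == 0)%N) s &
  forall x y, eval2 x y s = eval2 x 0 r.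
Proof.
exists (\sum_(i < size r) const2 _ (r`_i).[0] * (Z ^+ i * W ^+ 0)) => [|x y].
  by apply: span_sum => j _; apply: spanZ; apply: span_mon.
have -> : eval2 x 0 r = \sum_(i < size r) (r`_i).[0] * x ^+ i.
  rewrite /= /horner_eval (horner_coef r) horner_sum; apply: eq_bigr => i _.
  by rewrite hornerM -rmorphXn hornerC.
rewrite rmorph_sum; apply: eq_bigr => i _.
by rewrite rmorphM eval2_const eval2_mon mulr1.
Qed.

(** * Approximate inverses in norm and the passage from functions to polynomials *)

Section Main.

Variables (n m : nat) (c : nat -> nat -> Cx).
Hypothesis c_stable : stable (peval c n m).
Let cC i j := toC (c i j).
Local Notation p := (dpoly (const2 C) Z W n m cC).
Local Notation B := (form n m c).
Local Notation norm := (fnorm B).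

(** The point at which [1 - p * r] is evaluated may differ from the given one, so that this lemma
    serves for the inverses of [p], of [p(0, w)] and of [p(z, 0)]. *)
Lemma approx_norm (e : C) : 0 < e -> exists r : A,
  forall f : A, (forall x y, `|x| <= 1 -> `|y| <= 1 -> exists x' y',
     [/\ `|x'| <= 1, `|y'| <= 1 & eval2 x y f = 1 - eval2 x' y' (p * r)]) -> norm f <= e.
Proof.
move=> e0; have [d [K [d0 lower K0 HK]]] := exists_bound c_stable.
have lower' x y : `|x| <= 1 -> `|y| <= 1 ->
    d <= `|\sum_(i < n.+1) \sum_(j < m.+1) cC i j * (x ^+ i * y ^+ j)|.
  by move=> x1 y1; rewrite -eval2_dpoly; apply: lower.
have [r Hr] := approx_inverse d0 lower' (divr_gt0 e0 K0).
exists r => f Hf; have -> : e = K * (e / K) by rewrite mulrC divfK // gt_eqF.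
apply: HK => [|x y x1 y1]; first by rewrite divr_ge0 ?ltW.
by have [x' [y' [x'1 y'1 ->]]] := Hf x y x1 y1; apply: Hr.
Qed.

Lemma approx_inv (e : C) : 0 < e -> exists d r,
  span (fun i j => (i <= d)%N && (j <= d)%N) r /\ norm (1 - p * r) <= e.
Proof.
move=> /approx_norm[r Hr]; have [d Sd] := span_all r; exists d, r; split=> //.
by apply: Hr => x y x1 y1; exists x, y; split=> //; rewrite rmorphB rmorph1.
Qed.

Lemma approx_invw (e : C) : 0 < e -> exists r,
  span (fun i j => (i == 0)%N) r /\ norm (1 - upoly (const2 _) W m (cC 0) * r) <= e.
Proof.
move=> /approx_norm[r Hr]; have [s Ss Es] := restrict_w r; exists s; split=> //.
apply: Hr => x y x1 y1; exists 0, y; split=> //; first by rewrite normr0.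
rewrite rmorphB rmorph1 rmorphM eval2_upolyW Es rmorphM eval2_dpoly; congr (1 - _ * _).
rewrite [RHS]big_ord_recl [X in _ + X]big1 ?addr0 => [|i _].
  by apply: eq_bigr => j _; rewrite mul1r.
by rewrite big1 // => j _; rewrite lift0 expr0n !(mul0r, mulr0).
Qed.

Lemma approx_invz (e : C) : 0 < e -> exists r,
  span (fun i j => (j == 0)%N) r /\ norm (1 - upoly (const2 _) Z n (cC^~ 0%N) * r) <= e.
Proof.
move=> /approx_norm[r Hr]; have [s Ss Es] := restrict_z r; exists s; split=> //.
apply: Hr => x y x1 y1; exists x, 0; split=> //; first by rewrite normr0.
rewrite rmorphB rmorph1 rmorphM eval2_upolyZ Es rmorphM eval2_dpoly; congr (1 - _ * _).
apply: eq_bigr => i _; rewrite [RHS]big_ord_recl [X in _ + X]big1 ?addr0 => [|j _].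
  by rewrite mulr1.
by rewrite lift0 expr0n !mulr0.
Qed.

(** The coefficient is the value of [p] at the origin of the bidisk. *)
Lemma c00_neq0 : cC 0 0 != 0.
Proof.
have [d [K [d0 lower _ _]]] := exists_bound c_stable.
rewrite -normr_gt0 (lt_le_trans d0) //.
have := lower 0 0; rewrite normr0 => /(_ ler01 ler01).
rewrite eval2_dpoly big_ord_recl [X in _ + X]big1 ?addr0 => [|i _]; last first.
  by rewrite big1 // => j _; rewrite lift0 expr0n !(mul0r, mulr0).
rewrite big_ord_recl [X in _ + X]big1 ?addr0 => [|j _]; first by rewrite !expr0 !mulr1.
by rewrite lift0 exprS mul0r !mulr0.
Qed.

Lemma box_span i0 li j0 lj (f : fn2) : in_span_box i0 li j0 lj f ->
  exists2 F, span (fun i j => (i0 <= i < i0 + li)%N && (j0 <= j < j0 + lj)%N) F & fn_of F = f.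
Proof.
move=> [a Ha].
exists (\sum_(i < li) \sum_(j < lj)
  const2 _ (toC (a (i0 + i)%N (j0 + j)%N)) * (Z ^+ (i0 + i) * W ^+ (j0 + j))).
  apply: span_sum => i _; apply: span_sum => j _; apply: spanZ; apply: span_mon.
  by rewrite !leq_addr !ltn_add2l !ltn_ord.
apply: fn2_eq => z w; rewrite toC_fn_of Ha toC_csum rmorph_sum; apply: eq_bigr => i _.
rewrite toC_csum rmorph_sum; apply: eq_bigr => j _.
by rewrite rmorphM eval2_const eval2_mon !toCM !toCX.
Qed.

Lemma span_box i0 li j0 lj (F : A) :
  span (fun i j => (i0 <= i < i0 + li)%N && (j0 <= j < j0 + lj)%N) F ->
  in_span_box i0 li j0 lj (fn_of F).
Proof.
elim=> [|i j a f /andP[/andP[i1 i2] /andP[j1 j2]] _ [b Hb]].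
  exists (fun _ _ => Czero) => z w; apply: toC_inj; rewrite toC_fn_of rmorph0 toC_csum big1 // => i _.
  by rewrite toC_csum big1 // => j _; rewrite toCM toC0 mul0r.
exists (fun k l => Cadd (if (k == i) && (l == j) then ofC a else Czero) (b k l)) => z w.
apply: toC_inj; rewrite fn_ofD toCD Hb fn_ofM fn_of_const fn_of_mon !toCM !toCX ofCK.
rewrite !toC_csum.
under [RHS]eq_bigr => k _ do rewrite toC_csum.
under [RHS]eq_bigr => k _ do under eq_bigr => l _ do rewrite toCM toCD mulrDl.
under [RHS]eq_bigr => k _ do rewrite big_split.
rewrite big_split; congr (_ + _); last first.
  by apply: eq_bigr => k _; rewrite toC_csum; apply: eq_bigr => l _; rewrite toCM.
have ki : (i - i0 < li)%N by lia.
have lj' : (j - j0 < lj)%N by lia.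
rewrite (bigD1 (Ordinal ki)) //= (bigD1 (Ordinal lj')) //=.
rewrite !subnKC // !eqxx ofCK !toCM !toCX.
rewrite big1 => [|l]; last first.
  rewrite -val_eqE /= => /negPf lN.
  have -> : (j0 + l == j)%N = false by apply/negP => /eqP E; move: lN; rewrite -E addKn eqxx.
  by rewrite toC0 mul0r.
rewrite big1 => [|k]; first by rewrite !addr0.
rewrite -val_eqE /= => /negPf kN; rewrite big1 // => l _.
have -> : (i0 + k == i)%N = false by apply/negP => /eqP E; move: kN; rewrite -E addKn eqxx.
by rewrite toC0 mul0r.
Qed.

Lemma toC_eq0 a : toC a = 0 -> a = Czero.
Proof. by move=> a0; apply: toC_inj; rewrite a0. Qed.

Lemma ominus_boxP i0 li j0 lj i1 li1 j1 lj1 (F : A) :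
  span (fun i j => (i0 <= i < i0 + li)%N && (j0 <= j < j0 + lj)%N) F ->
  ominus_box (peval c n m) (in_span_box i0 li j0 lj) (in_span_box i1 li1 j1 lj1) (fn_of F) <->
  (forall i j, (i1 <= i < i1 + li1)%N -> (j1 <= j < j1 + lj1)%N -> B F (Z ^+ i * W ^+ j) = 0).
Proof.
move=> SF; split=> [[_ H] i j ii jj|H].
  have Hmon : in_span_box i1 li1 j1 lj1 (fn_of (Z ^+ i * W ^+ j)).
    by apply: span_box; apply: span_mon; rewrite ii jj.
  by rewrite /form (H _ Hmon).
split; first exact: span_box.
move=> g /box_span[G SG <-]; apply: toC_eq0.
apply: (span_orthr (form_hermitian c_stable) SG) => i j /andP[].
exact: H.
Qed.

Lemma H1_inH1 (F : A) :
  span (fun i j => (0 <= i < 0 + n.+1)%N && (0 <= j < 0 + m)%N) F ->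
  H1 (peval c n m) n m (fn_of F) <-> inH1 (const2 _) B Z W n m F.
Proof.
move=> SF; rewrite /H1 (ominus_boxP _ _ _ _ SF); split=> [H|[_ H]] => [|i j]; last exact: H.
by split=> [|i j i_n jm]; [apply: span_le SF => i j; lia | apply: H].
Qed.

Lemma H2_inH2 (F : A) :
  span (fun i j => (0 <= i < 0 + n)%N && (0 <= j < 0 + m.+1)%N) F ->
  H2t (peval c n m) n m (fn_of F) <-> inH2 (const2 _) B Z W n m F.
Proof.
move=> SF; rewrite /H2t (ominus_boxP _ _ _ _ SF); split=> [H|[_ H]] => [|i j i_n jm].
  split=> [|i j i_n jm]; first by apply: span_le SF => i j; lia.
  by apply: H => //; lia.
by apply: H => //; lia.
Qed.

(** The basis functions are lifted to polynomials one by one; expansions carry over because [fn_of]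
    is injective. *)
Lemma onb_lift (V : fn2 -> Prop) (Q : A -> Prop) d (e : nat -> fn2) :
  (forall f, V f -> exists2 F, Q F & fn_of F = f) -> (forall F, Q F -> V (fn_of F)) ->
  onb (peval c n m) V d e ->
  exists E : 'I_d -> A, [/\ forall k, fn_of (E k) = e k, forall k, Q (E k),
    orthonormal E B & forall F, Q F -> lincomb (const2 _) E F].
Proof.
move=> VQ QV [He [on gen]].
have [|E HE] := @fin_all_exists _ (fun=> A) (fun (k : 'I_d) F => Q F /\ fn_of F = e k).
  by move=> k; have [|F QF FE] := VQ (e k); [apply: He; apply/ssrnat.ltP | exists F].
have Ee k : fn_of (E k) = e k by have [] := HE k.
exists E; split=> // [k|k l|F QF]; first by have [] := HE k.
  rewrite /form !Ee on; try by apply/ssrnat.ltP.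
  have -> : Nat.eqb k l = (k == l) by apply/PeanoNat.Nat.eqb_spec/eqP => [/val_inj|->].
  by case: (k == l).
have [a Ha] := gen _ (QV F QF).
exists (fun k : 'I_d => toC (a k)); apply: fn_of_inj; apply: fn2_eq => z w.
rewrite Ha toC_csum toC_fn_of rmorph_sum; apply: eq_bigr => k _.
by rewrite rmorphM eval2_const toCM -Ee toC_fn_of.
Qed.

Lemma stable_kernel_formula (d1 : nat) (e1 : nat -> fn2) (d2 : nat) (e2 : nat -> fn2) :
  (0 < n)%N -> (0 < m)%N ->
  onb (peval c n m) (H1 (peval c n m) n m) d1 e1 ->
  onb (peval c n m) (H2t (peval c n m) n m) d2 e2 ->
  forall z w z1 w1 : Cx,
    Csub (Cmul (peval c n m z w) (Cconj (peval c n m z1 w1)))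
         (Cmul (ptilde c n m z w) (Cconj (ptilde c n m z1 w1)))
    = Cadd (Cmul (Csub Cone (Cmul w (Cconj w1))) (kernel d1 e1 z w z1 w1))
           (Cmul (Csub Cone (Cmul z (Cconj z1))) (kernel d2 e2 z w z1 w1)).
Proof.
move=> n0 m0 hK1 hK2 z w z1 w1.
have [||E1 [Ee1 E1Q E1on E1gen]] := onb_lift (Q := inH1 (const2 _) B Z W n m) _ _ hK1.
- move=> f Hf; have [F SF EF] := box_span (proj1 Hf); exists F => //.
  by apply/(H1_inH1 SF); rewrite EF.
- move=> F HF; apply/H1_inH1 => //; apply: span_le (proj1 HF) => i j; lia.
have [||E2 [Ee2 E2Q E2on E2gen]] := onb_lift (Q := inH2 (const2 _) B Z W n m) _ _ hK2.
- move=> f Hf; have [F SF EF] := box_span (proj1 Hf); exists F => //.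
  by apply/(H2_inH2 SF); rewrite EF.
- move=> F HF; apply/H2_inH2 => //; apply: span_le (proj1 HF) => i j; lia.
(* The evaluations at [(z, w)] and [(z1, w1)] are taken as [phi] and [psi]. *)
have := kernel_decomposition (form_hermitian c_stable) (form_z n m c) (form_w n m c)
  c00_neq0 (form_p_mon c_stable) approx_inv approx_invw approx_invz n0 m0 E1Q E2Q E1on E2on
  E1gen E2gen (eval2_const (toC z) (toC w)) (eval2_const (toC z1) (toC w1)).
rewrite !eval2Z !eval2W => K; apply: toC_inj.
have kernelE d (e : nat -> fn2) (E : 'I_d -> A) : (forall k, fn_of (E k) = e k) ->
    toC (kernel d e z w z1 w1) =
    \sum_k eval2 (toC z) (toC w) (E k) * (eval2 (toC z1) (toC w1) (E k))^*.
  by move=> Ee; rewrite toC_csum; apply: eq_bigr => k _; rewrite toCM toC_conj -Ee !toC_fn_of.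
rewrite toCB toCD !toCM !toCB !toCM !toC_conj toC1 !toC_peval !toC_ptilde.
by rewrite (kernelE _ _ _ Ee1) (kernelE _ _ _ Ee2).
Qed.

End Main.

End KernelFormula.

Theorem mainTheorem10 (n m : nat) (hn : (1 <= n)%nat) (hm : (1 <= m)%nat)
  (c : nat -> nat -> Cx)
  (hdeg : has_bidegree c n m)
  (hstab : stable (peval c n m))
  (d1 : nat) (e1 : nat -> fn2) (d2 : nat) (e2 : nat -> fn2)
  (hK1 : onb (peval c n m) (H1 (peval c n m) n m) d1 e1)
  (hK2 : onb (peval c n m) (H2t (peval c n m) n m) d2 e2) :
  forall z w z1 w1 : Cx,
    Csub (Cmul (peval c n m z w) (Cconj (peval c n m z1 w1)))
         (Cmul (ptilde c n m z w) (Cconj (ptilde c n m z1 w1)))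
    = Cadd (Cmul (Csub Cone (Cmul w (Cconj w1))) (kernel d1 e1 z w z1 w1))
           (Cmul (Csub Cone (Cmul z (Cconj z1))) (kernel d2 e2 z w z1 w1)).
Proof.
apply KernelFormula.stable_kernel_formula; try assumption.
- destruct n; [inversion hn | reflexivity].
- destruct m; [inversion hm | reflexivity].
Qed.
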